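(* Let $T$ be a complete first-order theory, $C$ a small set of parameters, $b_1,b_2$ tuples in the monster model of $T$, and $\kappa_1,\kappa_2$ cardinals. If there is an inp-pattern of depth $\kappa_1\times\kappa_2$ in $\operatorname{tp}(b_1b_2/C)$, then either there is an inp-pattern of depth $\kappa_1$ in $\operatorname{tp}(b_1/C)$, or there is an inp-pattern of depth $\kappa_2$ in $\operatorname{tp}(b_2/b_1C)$.
   Context: We work in a monster model $\mathbb{M}$ of a complete first-order theory $T$; no assumption is made on $T$. A set of formulas is $k$-inconsistent if every subset of $k$ of its members (with distinct indices) is inconsistent. An inp-pattern of depth $\kappa$ in a partial type $p(x)$ consists of an array of tuples $(a_{\alpha,i})_{\alpha<\kappa,i<\omega}$, formulas $\phi_\alpha(x,y_\alpha)$ and numbers $k_\alpha<\omega$ (for $\alpha<\kappa$) such that: (i) $\{\phi_\alpha(x,a_{\alpha,i})\}_{i<\omega}$ is $k_\alpha$-inconsistent for each $\alpha<\kappa$; (ii) $\{\phi_\alpha(x,a_{\alpha,f(\alpha)})\}_{\alpha<\kappa}\cup p(x)$ is consistent for every $f:\kappa\to\omega$. *)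

(* Defs.v *)
From mathcomp Require Import all_boot.
From mathcomp Require Import boolp classical_sets functions cardinality.

Set Implicit Arguments.
Unset Strict Implicit.
Unset Printing Implicit Defensive.

Local Open Scope classical_set_scope.
Local Open Scope card_scope.

Record language := Language {
  fsym : Type;
  farity : fsym -> nat;
  rsym : Type;
  rarity : rsym -> nat
}.

Inductive term (L : language) (V : Type) : Type :=
| tvar of V
| tapp (f : fsym L) of ('I_(farity f) -> term L V).

Arguments tvar {L V}.
Arguments tapp {L V} f.

(* Formulas whose free variables are indexed by V; the variable bound by
   fall is None : option V. *)
Inductive formula (L : language) (V : Type) : Type :=
| fbot
| feq of term L V & term L V
| frel (r : rsym L) of ('I_(rarity r) -> term L V)
| fimp of formula L V & formula L V
| fall of formula L (option V).

Arguments fbot {L V}.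
Arguments frel {L V} r.

Definition sentence (L : language) := formula L void.

Definition fneg (L : language) (V : Type) (phi : formula L V) := fimp phi fbot.

Fixpoint trename (L : language) (V W : Type) (g : V -> W) (t : term L V) :
    term L W :=
  match t with
  | tvar x => tvar (g x)
  | tapp f ts => tapp f (fun i => trename g (ts i))
  end.

Fixpoint frename (L : language) (V W : Type) (g : V -> W) (phi : formula L V) :
    formula L W :=
  match phi with
  | fbot => fbot
  | feq t u => feq (trename g t) (trename g u)
  | frel r ts => frel r (fun i => trename g (ts i))
  | fimp p q => fimp (frename g p) (frename g q)
  | fall p => fall (frename (omap g) p)
  end.

Record structure (L : language) := Structure {
  carrier :> Type;
  carrier_inh : inhabited carrier;
  fint : forall f : fsym L, ('I_(farity f) -> carrier) -> carrier;
  rint : forall r : rsym L, ('I_(rarity r) -> carrier) -> Prop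
}.

Fixpoint teval (L : language) (M : structure L) (V : Type) (v : V -> M)
    (t : term L V) : M :=
  match t with
  | tvar x => v x
  | tapp f ts => @fint L M f (fun i => teval v (ts i))
  end.

Fixpoint sat (L : language) (M : structure L) (V : Type) (v : V -> M)
    (phi : formula L V) : Prop :=
  match phi with
  | fbot => False
  | feq t u => teval v t = teval v u
  | frel r ts => @rint L M r (fun i => teval v (ts i))
  | fimp p q => sat v p -> sat v q
  | fall p => forall m : M, sat (oapp v m) p
  end.

Definition models (L : language) (M : structure L) (T : set (sentence L)) :=
  forall phi, T phi -> sat (of_void M) phi.

Definition entails (L : language) (T : set (sentence L)) (phi : sentence L) :=
  forall M : structure L, models M T -> sat (of_void M) phi.

Definition complete_theory (L : language) (T : set (sentence L)) :=
  (exists M : structure L, models M T) /\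
  (forall phi, entails T phi \/ entails T (fneg phi)).

(* Concatenation of tuples. *)
Definition tcat (X Y M : Type) (a : X -> M) (b : Y -> M) (z : X + Y) : M :=
  match z with inl x => a x | inr y => b y end.

(* A formula in the variables x = (x_i)_{i : X} with parameters in M is a
   formula over X + M, the variable inr m standing for the element m. *)
Definition pformula (L : language) (M : structure L) (X : Type) :=
  formula L (X + M).

(* phi(x, a) *)
Definition finst (L : language) (M : structure L) (X Y : Type)
    (phi : formula L (X + Y)) (a : Y -> M) : pformula M X :=
  frename (fun z => match z with inl x => inl x | inr y => inr (a y) end) phi.

Definition over (L : language) (M : structure L) (X : Type) (A : set M) :
    set (pformula M X) :=
  range (fun phi : formula L (X + A) => finst phi val).

Definition psat (L : language) (M : structure L) (X : Type) (x : X -> M)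
    (phi : pformula M X) : Prop :=
  sat (tcat x id) phi.

Definition realizes (L : language) (M : structure L) (X : Type) (x : X -> M)
    (G : set (pformula M X)) : Prop :=
  forall phi, G phi -> psat x phi.

(* By compactness: G is realized in some elementary extension of M. *)
Definition consistent (L : language) (M : structure L) (X : Type)
    (G : set (pformula M X)) : Prop :=
  forall D : set (pformula M X), finite_set D -> D `<=` G ->
    exists x : X -> M, realizes x D.

Definition tp (L : language) (M : structure L) (X : Type) (b : X -> M)
    (A : set M) : set (pformula M X) :=
  over A `&` [set phi | psat b phi].

(* A has cardinality strictly less than that of K. *)
Definition small (K U : Type) (A : set U) : Prop :=
  (A #<= [set: K]) /\ ~ ([set: K] #<= A).

Definition saturated (L : language) (K : Type) (M : structure L) : Prop :=
  forall (A : set M) (p : set (pformula M unit)),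
    small K A -> p `<=` over A -> consistent p -> exists x, realizes x p.

Definition elementary_on (L : language) (M : structure L) (A : set M)
    (g : A -> M) : Prop :=
  forall phi : formula L A, sat val phi <-> sat g phi.

Definition automorphism (L : language) (M : structure L) (s : M -> M) : Prop :=
  [/\ bijective s,
      forall f (v : 'I_(farity f) -> M),
        s (@fint L M f v) = @fint L M f (s \o v) &
      forall r (v : 'I_(rarity r) -> M), @rint L M r v <-> @rint L M r (s \o v)].

Definition strongly_homogeneous (L : language) (K : Type) (M : structure L) :
    Prop :=
  forall (A : set M) (g : A -> M), small K A -> elementary_on g ->
    exists2 s : M -> M, automorphism s & forall a : A, s (val a) = g a.

(* M is a monster model of T, the small sets being those of cardinality less
   than that of K. *)
Definition monster (L : language) (T : set (sentence L)) (K : Type)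
    (M : structure L) : Prop :=
  [/\ [/\ small K [set: nat], small K [set: fsym L] & small K [set: rsym L]],
      models M T, saturated K M & strongly_homogeneous K M].

Definition k_inconsistent (L : language) (M : structure L) (X : Type) (k : nat)
    (G : nat -> pformula M X) : Prop :=
  forall s : seq nat, uniq s -> size s = k -> ~ consistent (G @` [set` s]).

(* The depth kappa is the cardinality of the index type I of the rows. *)
Record inp_pattern (L : language) (M : structure L) (X I : Type)
    (p : set (pformula M X)) := InpPattern {
  inp_len : I -> nat;
  inp_param : forall i : I, nat -> 'I_(inp_len i) -> M;
  inp_form : forall i : I, formula L (X + 'I_(inp_len i));
  inp_k : I -> nat;
  inp_row : forall i : I,
    k_inconsistent (inp_k i) (fun n => finst (inp_form i) (@inp_param i n));
  inp_path : forall f : I -> nat,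
    consistent (range (fun i => finst (inp_form i) (@inp_param i (f i))) `|` p)
}.

Definition has_inp_pattern (L : language) (M : structure L) (X I : Type)
    (p : set (pformula M X)) : Prop :=
  inhabited (inp_pattern I p).

Arguments has_inp_pattern {L M X} I p.

(* Main.v *)
Require Import Defs.
From mathcomp Require Import all_boot.
From mathcomp Require Import boolp classical_sets functions cardinality.
From mathcomp Require Import wochoice filter.
From Stdlib Require List.
Local Open Scope classical_set_scope.

Set Implicit Arguments.
Unset Strict Implicit.
Unset Printing Implicit Defensive.

Local Open Scope card_scope.

(** Let the rows of the given pattern be indexed by the pairs (alpha, beta),
    alpha in kappa1 and beta in kappa2.

    The array can be replaced by one that is mutually indiscernible over C, in
    the strong sense that renumbering the entries of each row, independently and
    increasingly, is induced by an automorphism fixing C, and such that b1 b2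
    itself satisfies the formulas of all entries of index 0
    ([indiscernible_inp_pattern]).  In place of a partition theorem, the new
    array realizes the type that decides a formula on finitely many entries by
    taking limits along one free ultrafilter on nat, once for each entry, in the
    order of a fixed linear order of the positions ([indiscernible_array]).

    For each beta at most one alpha is then selected.  A set E of selected pairs
    is good if there is some x1 such that, wherever the entries of index 0 of the
    rows in E are moved inside their rows, x1 and the resulting entries have the
    type over C that b1 and the entries of index 0 have.  Only the rows in E and the rows (alpha, beta)
    with no pair selected for beta yet take part in these types: once a row is
    selected for beta, the other rows (alpha', beta) are forgotten.  By
    compactness a union of a chain of good sets is good ([good_bigcup]), so there
    is a maximal good E.

    If E selects a row for every beta, the formulas of these rows, with x1 in
    place of the first variables, form a pattern of depth kappa2 over x1 and C;
    an automorphism carries x1 to b1 ([inp_pattern_over_b1]).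

    Otherwise no row is selected for some beta0, and by maximality none of the
    rows (alpha, beta0) can be added to E.  For each alpha this inconsistency is
    finite: it yields a formula chi_alpha, true of x1 at the entry 0 of row
    (alpha, beta0), whose instances at the first N_alpha entries of this row are
    inconsistent; by indiscernibility so are those at any N_alpha entries.  The
    other parameters of chi_alpha lie in rows (alpha', beta) with beta different
    from beta0, because adding (alpha, beta0) forgets the other rows at beta0.  The rows (alpha, beta0) can therefore be
    renumbered independently while these parameters stay fixed, so the formulas
    chi_alpha form a pattern of depth kappa1 in tp(b1/C)
    ([inp_pattern_over_C]). *)

(** * Formulas, their variables, and automorphisms *)

Fixpoint tvars (L : language) (V : Type) (t : term L V) : set V :=
  match t with
  | tvar x => [set x]
  | tapp f ts => \bigcup_i tvars (ts i)
  end.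

Fixpoint fvars (L : language) (V : Type) (phi : formula L V) : set V :=
  match phi with
  | fbot => set0
  | feq t u => tvars t `|` tvars u
  | Defs.frel r ts => \bigcup_i tvars (ts i)
  | fimp p q => fvars p `|` fvars q
  | fall p => Some @^-1` fvars p
  end.

Lemma tvars_finite (L : language) (V : Type) (t : term L V) :
  finite_set (tvars t).
Proof.
elim: t => [x|f ts IH] /=; first exact: finite_set1.
by apply: bigcup_finite => //; exact: finite_finset.
Qed.

Lemma fvars_finite (L : language) (V : Type) (phi : formula L V) :
  finite_set (fvars phi).
Proof.
elim: phi => {V} [V|V t u|V r ts|V p IHp q IHq|V p IHp] /=.
- exact: finite_set0.
- by rewrite finite_setU; split; exact: tvars_finite.
- by apply: bigcup_finite => [|i _]; [exact: finite_finset|exact: tvars_finite].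
- by rewrite finite_setU.
- by apply: finite_preimage => // x y _ _ [].
Qed.

Lemma teval_ext (L : language) (M : structure L) (V : Type) (v w : V -> M)
    (t : term L V) :
  (forall x, tvars t x -> v x = w x) -> teval v t = teval w t.
Proof.
elim: t => [x|f ts IH] /= vw; first exact: vw.
by congr fint; apply/funext => i; apply: IH => x tx; apply: vw; exists i.
Qed.

Lemma sat_ext (L : language) (M : structure L) (V : Type) (v w : V -> M)
    (phi : formula L V) :
  (forall x, fvars phi x -> v x = w x) -> sat v phi <-> sat w phi.
Proof.
elim: phi v w => {V} [V|V t u|V r ts|V p IHp q IHq|V p IHp] v w /= vw.
- by [].
- by rewrite (@teval_ext _ _ _ v w t) ?(@teval_ext _ _ _ v w u) // => x xt;
    apply: vw; [right|left].
- suff -> : (fun i => teval v (ts i)) = (fun i => teval w (ts i)) by [].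
  by apply/funext => i; apply: teval_ext => x tx; apply: vw; exists i.
- have Hp : sat v p <-> sat w p by apply: IHp => x px; apply: vw; left.
  have Hq : sat v q <-> sat w q by apply: IHq => x px; apply: vw; right.
  by rewrite Hp Hq.
- by split=> H m; apply: (iffLR (IHp _ _ _)) (H m) => -[x|] //= px;
    rewrite vw.
Qed.

Lemma teval_rename (L : language) (M : structure L) (V W : Type) (g : V -> W)
    (v : W -> M) (t : term L V) :
  teval v (trename g t) = teval (v \o g) t.
Proof.
by elim: t => [x|f ts IH] //=; congr fint; apply/funext => i; exact: IH.
Qed.

Lemma sat_rename (L : language) (M : structure L) (V W : Type) (g : V -> W)
    (v : W -> M) (phi : formula L V) :
  sat v (frename g phi) <-> sat (v \o g) phi.
Proof.
elim: phi W g v => {V} [V|V t u|V r ts|V p IHp q IHq|V p IHp] W g v /=.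
- by [].
- by rewrite !teval_rename.
- suff -> : (fun i => teval v (trename g (ts i))) =
            (fun i => teval (v \o g) (ts i)) by [].
  by apply/funext => i; exact: teval_rename.
- by rewrite IHp IHq.
- have E m : oapp v m \o omap g = oapp (v \o g) m by apply/funext => -[].
  by split=> H m; move: (H m); rewrite IHp E.
Qed.

Lemma trename_comp (L : language) (U V W : Type) (g : V -> W) (h : U -> V)
    (t : term L U) :
  trename g (trename h t) = trename (g \o h) t.
Proof.
by elim: t => [x|f ts IH] //=; congr tapp; apply/funext => i; exact: IH.
Qed.

Lemma frename_comp (L : language) (U V W : Type) (g : V -> W) (h : U -> V)
    (phi : formula L U) :
  frename g (frename h phi) = frename (g \o h) phi.
Proof.
elim: phi V W g h => {U} [U|U t u|U r ts|U p IHp q IHq|U p IHp] V W g h /=.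
- by [].
- by rewrite !trename_comp.
- by congr Defs.frel; apply/funext => i; exact: trename_comp.
- by rewrite IHp IHq.
- by rewrite IHp; congr (fall (frename _ _)); apply/funext => -[].
Qed.

Lemma tvars_rename (L : language) (V W : Type) (g : V -> W) (t : term L V) :
  tvars (trename g t) `<=` g @` tvars t.
Proof.
elim: t => [x|f ts IH] /=; first by move=> _ ->; exists x.
by move=> y [i _ /IH[x tx <-]]; exists x => //; exists i.
Qed.

Lemma fvars_rename (L : language) (V W : Type) (g : V -> W) (phi : formula L V) :
  fvars (frename g phi) `<=` g @` fvars phi.
Proof.
elim: phi W g => {V} [V|V t u|V r ts|V p IHp q IHq|V p IHp] W g //= y.
- by move=> [] /(@tvars_rename _ _ _ g)[x xt <-]; exists x => //; [left|right].
- by move=> [i _ /(@tvars_rename _ _ _ g)[x tx <-]]; exists x => //; exists i.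
- by move=> [/(IHp _ g)|/(IHq _ g)] [x xt <-]; exists x => //; [left|right].
- by move=> /(IHp _ (omap g))[[x|]//= px [<-]]; exists x.
Qed.

Lemma trename_onto (L : language) (U V : Type) (g : U -> V) (t : term L V) :
  tvars t `<=` range g -> exists t', trename g t' = t.
Proof.
elim: t => [x|f ts IH] /= sub.
  by have [u _ ux] := sub x erefl; exists (tvar u); rewrite /= ux.
have /choice[ts' ts'E] : forall i, exists t', trename g t' = ts i.
  by move=> i; apply: IH => x tx; apply: sub; exists i.
by exists (tapp f ts') => /=; congr tapp; apply/funext.
Qed.

(** What makes formulas over an infinite type of variables finitary: a formula
    can be moved to any type whose image covers its free variables, in
    particular to a finite one. *)
Lemma frename_onto (L : language) (U V : Type) (g : U -> V) (phi : formula L V) :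
  fvars phi `<=` range g -> exists psi, frename g psi = phi.
Proof.
elim: phi U g => {V} [V|V t u|V r ts|V p IHp q IHq|V p IHp] U g /= sub.
- by exists fbot.
- have [|t' t'E] := @trename_onto _ _ _ g t; first by move=> x ?; apply: sub; left.
  have [|u' u'E] := @trename_onto _ _ _ g u; first by move=> x ?; apply: sub; right.
  by exists (feq t' u'); rewrite /= t'E u'E.
- have /choice[ts' ts'E] : forall i, exists t', trename g t' = ts i.
    by move=> i; apply: trename_onto => x tx; apply: sub; exists i.
  by exists (Defs.frel r ts') => /=; congr Defs.frel; apply/funext.
- have [|p' p'E] := IHp _ g; first by move=> x ?; apply: sub; left.
  have [|q' q'E] := IHq _ g; first by move=> x ?; apply: sub; right.
  by exists (fimp p' q'); rewrite /= p'E q'E.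
- have [|p' p'E] := IHp _ (omap g).
    move=> [x|] px; last by exists None.
    by have [u _ ux] := sub x px; exists (Some u); rewrite //= ux.
  by exists (fall p'); rewrite /= p'E.
Qed.

Definition fand (L : language) (V : Type) (p q : formula L V) :=
  fneg (fimp p (fneg q)).

Definition fconj (L : language) (V : Type) (s : seq (formula L V)) :=
  foldr (@fand L V) (fneg fbot) s.

Lemma sat_fand (L : language) (M : structure L) (V : Type) (v : V -> M)
    (p q : formula L V) :
  sat v (fand p q) <-> sat v p /\ sat v q.
Proof.
split=> /= [H|[vp vq] H]; last exact: H.
by apply: contrapT => /not_andP npq; apply: H => vp vq; case: npq.
Qed.

Lemma sat_fconj (L : language) (M : structure L) (V : Type) (v : V -> M)
    (s : seq (formula L V)) :
  sat v (fconj s) <-> forall p, List.In p s -> sat v p.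
Proof.
elim: s => [|p s IH]; first by split=> // _; apply.
rewrite /= -/(fconj s); apply: (iff_trans (sat_fand _ _ _)); rewrite IH.
split=> [[vp vs] q [<-//|/vs//]|H]; split; first by apply: H; left.
by move=> q qs; apply: H; right.
Qed.

Lemma fvars_fconj (L : language) (V : Type) (s : seq (formula L V)) phi :
  List.In phi s -> fvars phi `<=` fvars (fconj s).
Proof.
elim: s => //= psi s IH [->|phis] x xphi; left; [left|right; left] => //.
exact: IH.
Qed.

Lemma finite_list (T : Type) (D : set T) :
  finite_set D -> exists s : seq T, forall x, D x <-> List.In x s.
Proof.
move=> fin.
have /finite_seqP[s sE] : finite_set ((fun x => x : {classic T}) @` D).
  exact: finite_image.
exists s => x; have -> : List.In x s <-> (x : {classic T}) \in s.
  elim: (s) => //= y s' IH; rewrite inE IH; split=> [[->|->]|/orP[/eqP->|->]].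
  - by rewrite eqxx.
  - by rewrite orbT.
  - by left.
  - by right.
have -> : ((x : {classic T}) \in s) <-> [set` s] (x : {classic T}) by [].
by rewrite -sE; split=> [Dx|[y Dy <-]//]; exists x.
Qed.

Lemma finite_In (T : Type) (s : seq T) : finite_set [set x | List.In x s].
Proof.
elim: s => [|x s IH].
  by rewrite (_ : [set _ | _] = set0) //; apply/seteqP; split.
rewrite (_ : [set _ | _] = [set x] `|` [set y | List.In y s]).
  by rewrite finite_setU; split.
by apply/seteqP; split=> y [->|]; [left|right|left|right].
Qed.

(** Quantifying over a possibly infinite tuple x is first-order, since only the
    finitely many x-variables that occur matter; they are bound one at a time,
    and the other x-variables are dropped at the end. *)
Lemma formula_exists (L : language) (X W : Type) (phi : formula L (X + W)) :
  exists psi : formula L W, forall (M : structure L) (v : W -> M),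
    sat v psi <-> exists x : X -> M, sat (tcat x v) phi.
Proof.
have [s sE] : exists s : seq X, forall x, fvars phi (inl x) -> List.In x s.
  have [|s sE] := @finite_list _ (@inl X W @^-1` fvars phi).
    by apply: finite_preimage (fvars_finite phi) => x y _ _ [].
  by exists s => x /sE.
elim: s phi sE => [|x s IH] phi sE.
  have [|psi psiE] := @frename_onto _ _ _ (@inr X W) phi.
    by move=> [x /sE//|w _]; exists w.
  exists psi => M v; rewrite -psiE; split=> [vpsi|[x]]; last first.
    by rewrite sat_rename.
  have [m] := carrier_inh M.
  by exists (fun=> m); rewrite sat_rename.
pose g (z : X + W) : option (X + W) :=
  if z is inl y then (if `[< y = x >] then None else Some z) else Some z.
have [y|psi psiE] := IH (fneg (fall (frename g (fneg phi)))).
  move=> [|//] /(@fvars_rename _ _ _ g (fneg phi)) [z [zphi|//] gz].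
  case: z zphi gz => [z|w] //= /sE; case: asboolP => // zx [zE|].
    by case: zx.
  by move=> + [<-].
exists psi => M v; rewrite psiE.
have gE (y : X -> M) m : oapp (tcat y v) m \o g =
    tcat (fun z => if `[< z = x >] then m else y z) v.
  by apply/funext => -[z|w] //=; case: asboolP.
have gS (y : X -> M) m : sat (oapp (tcat y v) m) (frename g (fneg phi)) <->
    ~ sat (tcat (fun z => if `[< z = x >] then m else y z) v) phi.
  by rewrite sat_rename gE.
split=> [[y H]|[y yphi]].
  apply: contrapT => ne; apply: H => m; apply/(gS y m) => yphi; apply: ne.
  by exists (fun z => if `[< z = x >] then m else y z).
exists y => H; apply: (iffLR (gS y (y x)) (H (y x))).
suff -> : (fun z => if `[< z = x >] then y x else y z) = y by [].
by apply/funext => z; case: asboolP => // ->.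
Qed.

Lemma psat_finst (L : language) (M : structure L) (X W : Type) (x : X -> M)
    (e : W -> M) (phi : formula L (X + W)) :
  psat x (finst phi e) <-> sat (tcat x e) phi.
Proof.
rewrite /psat /finst sat_rename.
suff -> : tcat x id \o
  (fun z => match z with inl x => inl x | inr y => inr (e y) end) = tcat x e by [].
by apply/funext => -[].
Qed.

Lemma over_finst (L : language) (M : structure L) (X W : Type) (A : set M)
    (e : W -> M) (phi : formula L (X + W)) :
  range e `<=` A -> Defs.over A (finst phi e).
Proof.
move=> eA.
have eA' w : e w \in A by apply/mem_set/eA; exists w.
pose g (z : X + W) : X + A :=
  match z with inl x => inl x | inr w => inr (SigSub (eA' w)) end.
exists (frename g phi) => //; rewrite /finst frename_comp.
by congr frename; apply/funext => -[].
Qed.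

Lemma sat_automorphism (L : language) (M : structure L) (s : M -> M)
    (V : Type) (v : V -> M) (phi : formula L V) :
  automorphism s -> sat (s \o v) phi <-> sat v phi.
Proof.
move=> [bij_s sf sr].
have sE (U : Type) (w : U -> M) t : teval (s \o w) t = s (teval w t).
  elim: t => [x|f ts IH] //=; rewrite sf; congr fint.
  by apply/funext => i; exact: IH.
elim: phi v => {V} [V|V t u|V r ts|V p IHp q IHq|V p IHp] v /=.
- by [].
- by rewrite !sE; split=> [/(bij_inj bij_s)|->].
- rewrite (sr r (fun i => teval v (ts i))).
  suff -> : (fun i => teval (s \o v) (ts i)) = s \o (fun i => teval v (ts i)) by [].
  by apply/funext => i; exact: sE.
- by rewrite IHp IHq.
- have [s' s'K sK] := bij_s.
  have E m : oapp (s \o v) (s m) = s \o oapp v m by apply/funext => -[].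
  split=> H m; first by move: (H (s m)); rewrite E IHp.
  by rewrite -(sK m) E IHp.
Qed.

Lemma automorphism_inv (L : language) (M : structure L) (s : M -> M) :
  automorphism s ->
  exists s' : M -> M, [/\ automorphism s', cancel s s' & cancel s' s].
Proof.
move=> [[s' s'K sK] sf sr]; exists s'; split=> //; split.
- by exists s.
- move=> f v; apply: (can_inj s'K); rewrite sK sf; congr fint.
  by apply/funext => i /=; rewrite sK.
- move=> r v; rewrite (sr r (s' \o v)).
  suff -> : s \o (s' \o v) = v by [].
  by apply/funext => i /=; rewrite sK.
Qed.

Lemma automorphism_comp (L : language) (M : structure L) (s t : M -> M) :
  automorphism s -> automorphism t -> automorphism (s \o t).
Proof.
move=> [bs sf sr] [bt tf tr]; split; first exact: bij_comp.
- by move=> f v /=; rewrite tf sf.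
- by move=> r v; rewrite tr sr.
Qed.

(** * Cardinal arithmetic of small index types *)

Definition embeds (U W : Type) := exists f : U -> W, injective f.

Lemma embeds_refl (U : Type) : embeds U U.
Proof. by exists id. Qed.

Lemma embeds_trans (U V W : Type) : embeds U V -> embeds V W -> embeds U W.
Proof. by move=> [f fi] [g gi]; exists (g \o f); exact: inj_comp. Qed.

Lemma embeds_prod (U U' W W' : Type) :
  embeds U U' -> embeds W W' -> embeds (U * W) (U' * W').
Proof.
move=> [f fi] [g gi]; exists (fun p => (f p.1, g p.2)) => -[u w] [u' w'] /=.
by move=> [/fi-> /gi->].
Qed.

Lemma card_leTP (U W : Type) : [set: U] #<= [set: W] <-> embeds U W.
Proof.
split=> [/card_leP[f]|[f fi]].
  have inS (T : Type) (t : T) : t \in [set: T] by exact: in_setT.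
  exists (fun u => set_val (f (SigSub (inS _ u)))) => u u' /val_inj.
  by move=> /(@inj _ _ _ f)/= /(_ (in_setT _) (in_setT _)) [].
have /Pinj[g gE] : {in [set: U] &, injective f} by move=> x y _ _; exact: fi.
by rewrite -(@card_ge_image _ _ _ _ g setT) //; exact: card_leT.
Qed.

Lemma Zorn_above (T : Type) (P : set (set T)) (G0 : set T) :
  P G0 ->
  (forall F : set (set T), F !=set0 -> F `<=` P -> total_on F subset ->
    P (\bigcup_(X in F) X)) ->
  exists A, [/\ P A, G0 `<=` A & forall B, A `<=` B -> P B -> B = A].
Proof.
move=> PG0 Pchain.
have [F FP Ftot|A [PA Amax]] := @Zorn_bigcup T [set G | P (G `|` G0)].
  have [F0|/set0P/negP/negPn/eqP->] := pselect (F !=set0); last first.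
    by rewrite /= bigcup_set0 set0U.
  have UE : (\bigcup_(X in F) X) `|` G0 =
            \bigcup_(Y in [set X `|` G0 | X in F]) Y.
    rewrite bigcup_image; apply/seteqP; split=> x.
      case=> [[X FX Xx]|G0x]; first by exists X => //; left.
      by have [X FX] := F0; exists X => //; right.
    by move=> [X FX [Xx|]]; [left; exists X|right].
  rewrite /= UE.
  apply: Pchain; first by have [X FX] := F0; exists (X `|` G0), X.
    by move=> _ [X FX <-]; exact: FP.
  move=> _ _ [X FX <-] [Y FY <-].
  by have [XY|YX] := Ftot _ _ FX FY; [left|right]; exact: setSU.
exists (A `|` G0); split=> // B AB PB.
have BE : B `|` G0 = B by apply/setUidPl => x ?; apply: AB; right.
apply/seteqP; split=> //; apply: contrapT => nBA.
apply: (Amax B); last by rewrite /= BE.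
split; first by move=> x Ax; apply: AB; left.
by move=> BA; apply: nBA => x /BA; left.
Qed.

Lemma chain_finite (T : Type) (F : set (set T)) (l : seq T) :
  F !=set0 -> total_on F subset ->
  exists2 E, F E & forall x, List.In x l -> (\bigcup_(G in F) G) x -> E x.
Proof.
move=> [E0 FE0] Ftot; elim: l => [|x l [E FE El]]; first by exists E0.
have [[G FG Gx]|nU] := pselect ((\bigcup_(G in F) G) x); last first.
  by exists E => // y [<-//|/El].
have [EG|GE] := Ftot _ _ FE FG.
  by exists G => // y [<-//|yl /(El _ yl)/EG].
by exists E => // y [<- _|/El//]; exact: GE.
Qed.

Lemma embeds_total (U W : Type) : embeds U W \/ embeds W U.
Proof.
pose P : set (set (U * W)) := [set G |
  (forall u w w', G (u, w) -> G (u, w') -> w = w') /\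
  (forall u u' w, G (u, w) -> G (u', w) -> u = u')].
have [||G [[Gf Gi] _ Gmax]] := @Zorn_above _ P set0.
- by split.
- move=> F _ FP Ftot.
  have two p q : (\bigcup_(X in F) X) p -> (\bigcup_(X in F) X) q ->
      exists2 X, F X & X p /\ X q.
    move=> [X FX Xp] [Y FY Yq].
    by have [XY|YX] := Ftot _ _ FX FY; [exists Y|exists X] => //; split=> //;
      [exact: XY|exact: YX].
  split=> [u w w'|u u' w] h h'; have [X FX [Xp Xq]] := two _ _ h h'.
    exact: (FP X FX).1 Xp Xq.
  exact: (FP X FX).2 Xp Xq.
have [domG|/existsNP[u nu]] := pselect (forall u, exists w, G (u, w)).
  left; have [f fG] := choice domG; exists f => u u' ff.
  by apply: (Gi _ _ (f u)); rewrite // ff.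
have [ranG|/existsNP[w nw]] := pselect (forall w, exists u, G (u, w)).
  right; have [f fG] := choice ranG; exists f => w w' ff.
  by apply: (Gf (f w)); rewrite // ff.
suff GE : G `|` [set (u, w)] = G.
  by exfalso; apply: nu; exists w; rewrite -GE; right.
apply: Gmax; first by move=> x; left.
split=> [u1 w1 w2|u1 u2 w1] [G1|[-> ->]] [G2|].
- exact: Gf G1 G2.
- by move=> [E1 E2]; case: nu; exists w1; rewrite -E1.
- by case: nu; exists w2.
- by move=> [].
- exact: Gi G1 G2.
- by move=> [E1 E2]; case: nw; exists u1; rewrite -E2.
- by case: nw; exists u2.
- by move=> [].
Qed.

Lemma sval_inj (T : Type) (P : T -> Prop) : injective (@proj1_sig T P).
Proof. by move=> [x Px] [y Py] /= xy; exact: eq_exist. Qed.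

(** A graph G stands for a partial binary operation; its carrier is read off the
    diagonal, so that carriers commute with unions of chains of graphs. *)
Definition fld (X : Type) (G : set (X * X * X)) : set X :=
  [set x | exists c, G (x, x, c)].

Definition pairing_graph (X : Type) (G : set (X * X * X)) :=
  [/\ forall x y, fld G x -> fld G y -> exists c, G (x, y, c),
      forall x y c, G (x, y, c) -> [/\ fld G x, fld G y & fld G c],
      forall p c c', G (p, c) -> G (p, c') -> c = c' &
      forall p p' c, G (p, c) -> G (p', c) -> p = p'].

(** Hessenberg's theorem for injections.  Take a maximal injective operation
    f : A * A -> A extending one on a copy of nat.  If the complement of A embeds
    in A, then all of X embeds in A by tagging with f.  Otherwise A has a
    disjoint copy h(A), and f extends to the union of A and h(A): the three new
    blocks of pairs are sent into h(A), again by tagging with f. *)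
Lemma embeds_square (X : Type) : embeds nat X -> embeds (X * X) X.
Proof.
move=> [e ei].
pose G0 : set (X * X * X) :=
  [set t | exists i j : nat, t = (e i, e j, e (choice.pickle (i, j)))].
have fldG0 x : fld G0 x <-> exists i, x = e i.
  split=> [[c [i [j [-> _ _]]]]|[i ->]]; first by exists i.
  by exists (e (choice.pickle (i, i))), i, i.
have pG0 : pairing_graph G0.
  split.
  - move=> x y /fldG0[i ->] /fldG0[j ->].
    by exists (e (choice.pickle (i, j))), i, j.
  - move=> _ _ _ [i [j [-> -> ->]]].
    by split; apply/fldG0; [exists i|exists j|exists (choice.pickle (i, j))].
  - move=> p c c' [i [j [-> ->]]] [i' [j' [/ei-> /ei-> ->]]] //.
  - move=> p p' c [i [j [-> ->]]] [i' [j' [-> /ei]]].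
    by move=> /(pcan_inj choice.pickleK)[-> ->].
have [//|F _ FP Ftot|G [[Gt Gfld Gf Gi] G0G Gmax]] :=
    @Zorn_above _ (@pairing_graph X) G0.
  have two p q : (\bigcup_(Y in F) Y) p -> (\bigcup_(Y in F) Y) q ->
      exists2 Y, F Y & Y p /\ Y q.
    move=> [Y FY Yp] [Z FZ Zq].
    by have [YZ|ZY] := Ftot _ _ FY FZ; [exists Z|exists Y] => //; split=> //;
      [exact: YZ|exact: ZY].
  split.
  - move=> x y [c Fc] [d Fd]; have [Y FY [Yc Yd]] := two _ _ Fc Fd.
    have [+ _ _ _] := FP _ FY.
    by move=> /(_ x y) [||z Yz]; [exists c|exists d|exists z, Y].
  - move=> x y c [Y FY Yc]; have [_ + _ _] := FP _ FY.
    by move=> /(_ _ _ _ Yc)[[x' ?] [y' ?] [c' ?]]; split;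
      [exists x'|exists y'|exists c']; exists Y.
  - move=> p c c' h h'; have [Y FY [Y1 Y2]] := two _ _ h h'.
    by have [_ _ Yf _] := FP _ FY; exact: Yf Y1 Y2.
  - move=> p p' c h h'; have [Y FY [Y1 Y2]] := two _ _ h h'.
    by have [_ _ _ Yi] := FP _ FY; exact: Yi Y1 Y2.
set A := fld G.
have Ae i : A (e i).
  by exists (e (choice.pickle (i, i))); apply: G0G; exists i, i.
have [f fG] : exists f : X * X -> X, forall p, A p.1 -> A p.2 -> G (p, f p).
  suff /choice[f fG] : forall p, exists c, A p.1 -> A p.2 -> G (p, c) by exists f.
  move=> [x y] /=.
  have [[Ax Ay]|nA] := pselect (A x /\ A y).
    by have [c Gc] := Gt _ _ Ax Ay; exists c.
  by exists x => Ax Ay; case: nA.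
have fA x y : A x -> A y -> A (f (x, y)).
  by move=> Ax Ay; have [] := Gfld _ _ _ (fG (x, y) Ax Ay).
have fi x y x' y' : A x -> A y -> A x' -> A y' -> f (x, y) = f (x', y') ->
    x = x' /\ y = y'.
  move=> Ax Ay Ax' Ay' ff.
  have /Gi := fG (x, y) Ax Ay; rewrite ff.
  by move=> /(_ _ (fG (x', y') Ax' Ay')) [].
have [[h hi]|[h hi]] := embeds_total {x | ~ A x} {x | A x}.
  pose j x : X := match pselect (A x) with
    | left _ => f (x, e 0) | right nAx => f (sval (h (exist _ x nAx)), e 1) end.
  have Aj x : A (j x).
    rewrite /j; case: pselect => [Ax|nAx]; apply: fA => //.
    exact: (svalP (h (exist _ x nAx))).
  have ji : injective j.
    move=> x y; rewrite /j; case: pselect => Ax; case: pselect => Ay.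
    - by move=> /fi[].
    - move=> /fi[]//; first exact: (svalP (h _)).
      by move=> _ /ei.
    - move=> /fi[]//; first exact: (svalP (h _)).
      by move=> _ /ei.
    - move=> /fi[]//; try exact: (svalP (h _)).
      move=> hh _; suff /hi[] : h (exist _ x Ax) = h (exist _ y Ay) by [].
      exact: sval_inj.
  exists (fun p => f (j p.1, j p.2)) => -[x y] [x' y'] /= /fi[]//.
  by move=> /ji-> /ji->.
pose lift (i : bool) (x : {x | A x}) : X := if i then sval (h x) else sval x.
have lifti i x j y : lift i x = lift j y -> i = j /\ x = y.
  case: i j => -[] /=.
  - by move=> hh; split=> //; apply: hi; exact: sval_inj.
  - by move=> hh; case: (svalP (h x)); rewrite hh; exact: svalP.
  - by move=> hh; case: (svalP (h y)); rewrite -hh; exact: svalP.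
  - by move=> hh; split=> //; exact: sval_inj.
have Af (x y : {x | A x}) i : A (f (f (sval x, sval y), e i)).
  by apply: (fA) => //; apply: (fA); exact: svalP.
(* the blocks are told apart by the tag i + 2j; i and j say which coordinates
   lie in the copy of A *)
pose c i (x : {x | A x}) j (y : {x | A x}) : {x | A x} :=
  exist A _ (Af x y (i + j.*2)).
have ci i x j y i' x' j' y' :
    c i x j y = c i' x' j' y' -> x = x' /\ y = y'.
  move=> /(congr1 sval) /= /fi[]//; try by apply: fA; exact: svalP.
  move=> /fi[]//; try exact: svalP.
  by move=> xx yy _; split; exact: sval_inj.
have cij i x j y i' x' j' y' :
    c (nat_of_bool i) x (nat_of_bool j) y =
    c (nat_of_bool i') x' (nat_of_bool j') y' -> i = i' /\ j = j'.
  move=> /(congr1 sval) /= /fi[]//; try by apply: fA; exact: svalP.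
  by move=> _ /ei; case: i i' j j' => -[] [] [].
pose G' := G `|` [set t | exists i x j y, [/\ i || j &
   t = (lift i x, lift j y, lift true (c (nat_of_bool i) x (nat_of_bool j) y))]].
have GA t : G t -> [/\ A t.1.1, A t.1.2 & A t.2].
  by case: t => -[x y] z /Gfld.
have nAh x : ~ A (lift true x) by exact: (svalP (h x)).
have fldG' z : fld G' z <-> exists i x, z = lift i x.
  split=> [[d [/Gfld[Az _ _]|[i [x [j [y [_ [-> _ _]]]]]]]]|].
  - by exists false, (exist _ z Az).
  - by exists i, x.
  - move=> [[] [x ->]]; last first.
      by have [d] := svalP x; exists d; left.
    by exists (lift true (c 1 x 1 x)); right; exists true, x, true, x.
suff G'E : G' = G.
  pose x0 : {x | A x} := exist A _ (Ae 0).
  case: (nAh x0); rewrite /A -G'E.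
  by apply/fldG'; exists true, x0.
apply: Gmax; first by move=> t; left.
split.
- move=> z w /fldG'[i [x ->]] /fldG'[j [y ->]].
  have [ij|] := boolP (i || j).
    exists (lift true (c (nat_of_bool i) x (nat_of_bool j) y)).
    by right; exists i, x, j, y.
  case: i j => -[]//= _; have [d Gd] := Gt _ _ (svalP x) (svalP y).
  by exists d; left.
- move=> z w d [/GA[/= Az Aw Ad]|[i [x [j [y [_ [-> -> ->]]]]]]].
    by split; apply/fldG'; exists false; [exists (exist _ z Az)|
      exists (exist _ w Aw)|exists (exist _ d Ad)].
  by split; apply/fldG'; [exists i, x|exists j, y|
    exists true, (c (nat_of_bool i) x (nat_of_bool j) y)].
- have mixed i x j y d : i || j -> ~ G (lift i x, lift j y, d).
    by move=> /orP[]-> /GA[/= A1 A2 _]; [apply: nAh A1|apply: nAh A2].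
  move=> p d d' [Gd|[i [x [j [y [ij [pE ->]]]]]]]
    [Gd'|[i' [x' [j' [y' [ij' [pE' ->]]]]]]].
  + exact: Gf Gd Gd'.
  + by move: Gd; rewrite pE' => /mixed-/(_ ij').
  + by move: Gd'; rewrite pE => /mixed-/(_ ij).
  + by move: pE'; rewrite pE => -[/lifti[-> ->] /lifti[-> ->]].
- move=> p p' d [Gd|[i [x [j [y [ij [-> ->]]]]]]]
    [Gd'|[i' [x' [j' [y' [ij' [-> dE]]]]]]].
  + exact: Gi Gd Gd'.
  + by move: Gd => /GA[_ _]; rewrite dE => /nAh.
  + by move: Gd' => /GA[_ _] /nAh.
  + have [_ cE] := lifti true _ true _ dE.
    by have [-> ->] := ci _ _ _ _ _ _ _ _ cE; have [-> ->] := cij _ _ _ _ _ _ _ _ cE.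
Qed.

(** Smallness in terms of injections between types, which also makes sense for
    index types that are not sets in the model. *)
Definition smallT (K U : Type) := embeds U K /\ ~ embeds K U.

Lemma smallTP (K U : Type) : small K [set: U] <-> smallT K U.
Proof. by rewrite /small !card_leTP. Qed.

Lemma small_setP (K U : Type) (A : set U) : small K A <-> smallT K A.
Proof.
have e : [set: A] #= A := card_setT A.
by rewrite -smallTP /small (card_le_eql e) (card_le_eqr e).
Qed.

Lemma smallT_embeds (K U W : Type) : embeds U W -> smallT K W -> smallT K U.
Proof.
move=> UW [WK nKW]; split; first exact: embeds_trans WK.
by move=> KU; apply: nKW; exact: embeds_trans UW.
Qed.

Lemma smallT_common (K U W : Type) :
  smallT K nat -> smallT K U -> smallT K W ->
  exists Y, [/\ smallT K Y, embeds U Y, embeds W Y & embeds nat Y].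
Proof.
suff max U1 U2 : smallT K U1 -> smallT K U2 ->
    exists Y, [/\ smallT K Y, embeds U1 Y & embeds U2 Y].
  move=> sN sU sW; have [Y [sY UY WY]] := max _ _ sU sW.
  have [Z [sZ YZ NZ]] := max _ _ sY sN.
  by exists Z; split=> //; exact: embeds_trans YZ.
move=> s1 s2; have [e|e] := embeds_total U1 U2; [exists U2|exists U1];
  by split=> //; exact: embeds_refl.
Qed.

Lemma smallT_prod (K U W : Type) :
  smallT K nat -> smallT K U -> smallT K W -> smallT K (U * W).
Proof.
move=> sN sU sW; have [Y [sY UY WY NY]] := smallT_common sN sU sW.
apply: smallT_embeds sY.
by apply: embeds_trans (embeds_square NY); exact: embeds_prod.
Qed.

Lemma smallT_sum (K U W : Type) :
  smallT K nat -> smallT K U -> smallT K W -> smallT K (U + W).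
Proof.
move=> sN sU sW; have [Y [sY [f fi] [g gi] NY]] := smallT_common sN sU sW.
apply: smallT_embeds sY; apply: embeds_trans (embeds_square NY).
have [e ei] := NY.
exists (fun z => match z with inl u => (e 0, f u) | inr w => (e 1, g w) end).
by move=> [u|w] [u'|w'] [] => [/fi->|/ei|/ei|/gi->].
Qed.

Lemma smallT_sigT (K R : Type) (S : R -> Type) (Y : Type) :
  smallT K nat -> smallT K R -> smallT K Y -> (forall r, embeds (S r) Y) ->
  smallT K {r & S r}.
Proof.
move=> sN sR sY SY; apply: smallT_embeds (smallT_prod sN sR sY).
pose f r := sval (cid (SY r)); have fi r : injective (f r) := svalP (cid (SY r)).
exists (fun z => (tag z, f _ (tagged z))) => -[r s] [r' s'] /= [rr].
by move: s'; rewrite -rr => s' /fi->.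
Qed.

Lemma smallT_range (K U W : Type) (f : U -> W) :
  smallT K U -> smallT K (range f).
Proof.
apply: smallT_embeds; apply/card_leTP.
by rewrite (card_le_eql (card_setT (range f))) card_image_le.
Qed.

(** * Saturation and homogeneity for families of variables *)

(** Saturation for one variable extends to small tuples of variables: a maximal
    finitely satisfiable partial assignment G is total.  If x were unassigned,
    the formulas of a one-variable type would say of a possible value of x that
    finitely many formulas of F have a common solution extending G, the remaining
    variables being quantified away. *)
Lemma saturated_realizes (L : language) (K : Type) (M : structure L)
    (V W : Type) (e : W -> M) (F : set (formula L (V + W))) :
  saturated K M -> smallT K nat -> smallT K V -> smallT K W ->
  (forall s, (forall phi, List.In phi s -> F phi) ->
    exists v : V -> M, forall phi, List.In phi s -> sat (tcat v e) phi) ->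
  exists v : V -> M, forall phi, F phi -> sat (tcat v e) phi.
Proof.
move=> satM sN sV sW FIP.
pose fits (G : set (V * M)) (v : V -> M) := forall x m, G (x, m) -> v x = m.
pose good : set (set (V * M)) := [set G |
  forall s, (forall phi, List.In phi s -> F phi) ->
  exists v : V -> M, fits G v /\ forall phi, List.In phi s -> sat (tcat v e) phi].
have [||G [Ggood _ Gmax]] := @Zorn_above _ good set0.
- by move=> s /FIP[v vs]; exists v; split=> [x m []|].
- move=> C C0 Cgood Ctot s sF.
  set U := \bigcup_(G in C) G.
  have Ufun x m m' : U (x, m) -> U (x, m') -> m = m'.
    move=> Um Um'; have [G CG Gl] := chain_finite [:: (x, m); (x, m')] C0 Ctot.
    have [|v [vG _]] := Cgood _ CG [::]; first by [].
    rewrite -(vG x m) ?(vG x m') //; apply: Gl => //; first by right; left.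
    by left.
  have /choice[u uE] : forall x, exists m, forall m', U (x, m') -> m = m'.
    move=> x; have [[m Um]|nU] := pselect (exists m, U (x, m)).
      by exists m => m'; exact: Ufun.
    by have [m] := carrier_inh M; exists m => m' Um'; case: nU; exists m'.
  have [l lE] : exists l, forall x, fvars (fconj s) (inl x) -> List.In x l.
    have [|l lE] := @finite_list _ (@inl V W @^-1` fvars (fconj s)).
      by apply: finite_preimage (fvars_finite (fconj s)) => x y _ _ [].
    by exists l => x /lE.
  have [G CG GU] := chain_finite [seq (x, u x) | x <- l] C0 Ctot.
  have [v [vG vs]] := Cgood _ CG _ sF.
  pose w x := if `[< exists m, U (x, m) >] then u x else v x.
  exists w; split=> [x m Um|].
    by rewrite /w asboolT; [exact: uE|exists m].
  (* w extends all of U, and agrees with v on the variables of s *)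
  apply/sat_fconj; apply: (iffLR (sat_ext _)) (iffRL (sat_fconj _ _) vs).
  move=> [x /lE xl|//] /=; rewrite /w; case: asboolP => // -[m Um].
  rewrite (uE _ _ Um); apply: vG; rewrite -(uE _ _ Um); apply: GU.
    by apply/List.in_map_iff; exists x.
  by rewrite (uE _ _ Um).
have [v0 v0G] : exists v, fits G v.
  by have [|v [vG _]] := Ggood [::]; [by []|exists v].
suff Gtot x : exists m, G (x, m).
  exists v0 => phi Fphi.
  have [_ [<-//|//]|v [vG vphi]] := Ggood [:: phi].
  have <- : v = v0.
    by apply/funext => x; have [m Gm] := Gtot x; rewrite (vG _ _ Gm) (v0G _ _ Gm).
  by apply: vphi; left.
apply: contrapT => nGx.
pose hit s (y : unit -> M) := exists v, [/\ fits G v, v x = y tt &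
  forall phi, List.In phi s -> sat (tcat v e) phi].
have hitP s : exists theta : formula L (unit + (V + W)),
    forall y, sat (tcat y (tcat v0 e)) theta <-> hit s y.
  (* unassigned variables other than x stay quantifiable; assigned ones become
     parameters, with their value given by v0 *)
  pose rho (z : V + W) : V + (unit + (V + W)) := match z with
    | inl z => if `[< z = x >] then inr (inl tt)
               else if `[< exists m, G (z, m) >] then inr (inr (inl z)) else inl z
    | inr w => inr (inr (inr w)) end.
  have [theta thetaE] := formula_exists (frename rho (fconj s)).
  exists theta => y; rewrite thetaE; split=> [[u]|[v [vG vx vs]]].
    rewrite sat_rename => us.
    pose v z := if `[< z = x >] then y tt
               else if `[< exists m, G (z, m) >] then v0 z else u z.
    have vE : tcat u (tcat y (tcat v0 e)) \o rho = tcat v e.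
      apply/funext => -[z|w] //=; rewrite /v.
      by case: asboolP => // _; case: asboolP.
    exists v; split=> [z m Gm||phi].
    - rewrite /v; case: asboolP => [zx|_]; first by case: nGx; exists m; rewrite -zx.
      by case: asboolP => [_|[]]; [exact: v0G|exists m].
    - by rewrite /v; case: asboolP.
    - by move: phi; apply/sat_fconj; rewrite -vE.
  exists v; rewrite sat_rename.
  suff -> : tcat v (tcat y (tcat v0 e)) \o rho = tcat v e by apply/sat_fconj.
  apply/funext => -[z|w] //=.
  case: asboolP => [->//|_]; case: asboolP => // -[m Gm] /=.
  by rewrite (v0G _ _ Gm) (vG _ _ Gm).
pose p : set (pformula M unit) := [set theta |
  exists2 th, theta = finst th (tcat v0 e) &
  exists2 s, (forall phi, List.In phi s -> F phi) &
    forall y, sat (tcat y (tcat v0 e)) th <-> hit s y].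
have [||D /finite_list[l lE] Dp|y yp] := satM (range (tcat v0 e)) p.
- by apply/small_setP; apply: smallT_range; exact: smallT_sum.
- by move=> _ [th -> _]; exact: over_finst.
- have [S SF Sy] : exists2 S, (forall phi, List.In phi S -> F phi) &
      forall y, hit S y -> forall theta, List.In theta l -> psat y theta.
    have : forall theta, List.In theta l -> p theta by move=> theta /lE/Dp.
    elim: (l) => [|theta l' IH] lp; first by exists [::].
    have [|S SF Sy] := IH; first by move=> th thl; apply: lp; right.
    have [th thE [s sF sE]] := lp theta (or_introl erefl).
    exists (s ++ S) => [phi phisS|y [v [vG vx vs]]].
      by have [/sF|/SF] := List.in_app_or _ _ _ phisS.
    move=> th' [<-|]; last first.
      by apply: Sy; exists v; split=> // phi ?; apply/vs/List.in_or_app; right.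
    rewrite thE psat_finst sE; exists v; split=> // phi ?.
    by apply/vs/List.in_or_app; left.
  have [v [vG vS]] := Ggood _ SF.
  exists (fun=> v x) => theta /lE; apply: Sy.
  by exists v.
suff GE : G `|` [set (x, y tt)] = G by apply: nGx; exists (y tt); rewrite -GE; right.
apply: Gmax => [z|]; first by left.
move=> s sF; have [th thE] := hitP s.
have : psat y (finst th (tcat v0 e)) by apply: yp; exists th => //; exists s.
rewrite psat_finst thE => -[v [vG vx vs]]; exists v; split=> // z m.
by move=> [/vG//|[-> ->]].
Qed.

Lemma saturated_realizes_image (L : language) (K : Type) (M : structure L)
    (V W I : Type) (e : W -> M) (D : set I) (F : I -> formula L (V + W)) :
  saturated K M -> smallT K nat -> smallT K V -> smallT K W ->
  (forall s, (forall i, List.In i s -> D i) ->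
    exists v : V -> M, forall i, List.In i s -> sat (tcat v e) (F i)) ->
  exists v : V -> M, forall i, D i -> sat (tcat v e) (F i).
Proof.
move=> satM sN sV sW FIP.
have [s sDF|v vF] := @saturated_realizes L K M V W e (F @` D) satM sN sV sW.
  have [t [tD tF]] : exists t, (forall i, List.In i t -> D i) /\
      forall phi, List.In phi s -> exists2 i, List.In i t & F i = phi.
    elim: s sDF => [|phi s IH] sDF; first by exists [::].
    have [|t [tD tF]] := IH; first by move=> psi ?; apply: sDF; right.
    have [i Di Fi] := sDF phi (or_introl erefl).
    exists (i :: t); split=> [j [<-//|/tD//]|psi [<-|/tF[j jt Fj]]].
      by exists i => //; left.
    by exists j => //; right.
  have [v vt] := FIP t tD; exists v => phi /tF[i it <-]; exact: vt.
by exists v => i Di; apply: vF; exists i.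
Qed.

(** Strong homogeneity for indexed families.  One implication between the types
    of the families is enough, because types are closed under negation. *)
Lemma homogeneous_automorphism (L : language) (K : Type) (M : structure L)
    (Z : Type) (v w : Z -> M) :
  strongly_homogeneous K M -> smallT K Z ->
  (forall theta : formula L Z, sat v theta -> sat w theta) ->
  exists s : M -> M, automorphism s /\ forall z, s (v z) = w z.
Proof.
move=> homM sZ vw.
have wv theta : sat w theta -> sat v theta.
  by move=> wth; apply: contrapT => /(vw (fneg theta)) /(_ wth).
have vz (a : range v) : exists z, v z = val a.
  by have [z _ <-] := set_mem (valP a); exists z.
have [c cE] := choice vz.
have cz z z' : v z = v z' -> w z = w z' by exact: vw (feq (tvar z) (tvar z')).
have [|theta|s auts sE] := homM (range v) (w \o c).
- by apply/small_setP; exact: smallT_range.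
- have -> : val = v \o c by apply/funext => a; rewrite /= cE.
  by split=> /sat_rename h; apply/sat_rename; [exact: vw|exact: wv].
exists s; split=> // z.
have zv : v z \in range v by apply/mem_set; exists z.
by rewrite (sE (SigSub zv)) /=; apply: cz; rewrite cE.
Qed.

(** * Iterated limits along a free ultrafilter *)

Lemma linear_order (T : eqType) :
  exists le : rel T, [/\ total le, transitive le & antisymmetric le].
Proof.
have [le wo] := well_ordering_principle T.
have min3 x y z : exists m, [/\ m \in [:: x; y; z], le m x, le m y & le m z].
  have [|m [[mS mlb] _]] := wo (mem [:: x; y; z]); first by exists x; exact: mem_head.
  by exists m; split=> //; apply: mlb; rewrite !inE eqxx ?orbT.
have lexx x : le x x.
  by have [m []] := min3 x x x; rewrite !inE !orbb => /eqP->.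
have anti : antisymmetric le.
  move=> x y /andP[xy yx].
  have [|m [_ um]] := wo (mem [:: x; y]); first by exists x; exact: mem_head.
  rewrite -(um x) ?(um y) //; split; rewrite ?inE ?eqxx ?orbT //;
    by move=> z; rewrite !inE => /orP[]/eqP->.
exists le; split=> //.
- move=> x y; have [m [+ mx my _]] := min3 x y y.
  rewrite !inE orbb => /orP[]/eqP E; move: mx my; rewrite E => mx my.
    by rewrite my.
  by rewrite mx orbT.
- move=> y x z xy yz; have [m [+ mx my mz]] := min3 x y z.
  rewrite !inE => /or3P[]/eqP E; rewrite {}E {m} in mx my mz => //.
    by rewrite (anti x y) ?xy.
  by rewrite -(anti y z) ?yz.
Qed.

Definition free_ultrafilter (U : set (set nat)) :=
  UltraFilter U /\ forall n, U [set m | n <= m].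

Lemma free_ultrafilter_ex : exists U, free_ultrafilter U.
Proof.
pose F : set (set nat) := [set A | exists n, forall m, n <= m -> A m].
have FF : ProperFilter F.
  split; first by move=> [n /(_ n (leqnn n))].
  split; first by exists 0.
    move=> A B [m mA] [n nB]; exists (maxn m n) => k; rewrite geq_max.
    by move=> /andP[/mA ? /nB ?].
  by move=> A B AB [n nA]; exists n => m /nA/AB.
have [U [UU FU]] := ultraFilterLemma FF.
by exists U; split=> // n; apply: FU; exists n.
Qed.

Section IteratedLimit.
Variables (U : set (set nat)) (UU : free_ultrafilter U) (J : eqType).
Implicit Types (s : seq J) (P Q : (J -> nat) -> Prop) (g h : J -> nat).

#[local] Instance UU1 : UltraFilter U := UU.1.

Lemma ultraN (A : set nat) : U (~` A) <-> ~ U A.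
Proof.
split=> [UA UB|nUA]; last by have [] := in_ultra_setVsetC A UU1.
by apply: (@filter_not_empty _ U _); rewrite -(setICr A); exact: filterI.
Qed.

Lemma ultraI (A B : set nat) : U (A `&` B) <-> U A /\ U B.
Proof.
split=> [UAB|[UA UB]]; last exact: filterI.
by split; apply: filterS UAB => n [].
Qed.

Definition upd h j n : J -> nat := fun i => if i == j then n else h i.

(** The first position of s carries the outermost limit; positions outside s
    keep the values of h. *)
Fixpoint Lim s P h : Prop :=
  if s is j :: s' then U [set n | Lim s' P (upd h j n)] else P h.

Lemma LimN s P h : Lim s (fun g => ~ P g) h <-> ~ Lim s P h.
Proof.
elim: s h => [|j s IH] h //=; rewrite -ultraN.
suff -> : [set n | Lim s (fun g => ~ P g) (upd h j n)] =
  ~` [set n | Lim s P (upd h j n)] by [].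
by apply/seteqP; split=> n /=; rewrite IH.
Qed.

Lemma LimI s P Q h :
  Lim s (fun g => P g /\ Q g) h <-> Lim s P h /\ Lim s Q h.
Proof.
elim: s h => [|j s IH] h //=; rewrite -ultraI.
suff -> : [set n | Lim s (fun g => P g /\ Q g) (upd h j n)] =
  [set n | Lim s P (upd h j n)] `&` [set n | Lim s Q (upd h j n)] by [].
by apply/seteqP; split=> n /=; rewrite IH.
Qed.

Lemma Lim_ex s P h : Lim s P h -> exists g, P g.
Proof.
elim: s h => [|j s IH] h /=; first by exists h.
by move=> /filter_ex[n /IH].
Qed.

(** The values met along an iterated limit can be taken pairwise distinct, as U
    contains every final segment of nat. *)
Lemma Lim_generic s P h :
  uniq s -> (forall g, {in s &, injective g} -> P g) -> Lim s P h.
Proof.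
move=> us Pinj.
suff gen N : (forall g, (forall j, j \notin s -> g j = h j) ->
    {in s &, injective g} -> (forall j, j \in s -> N <= g j) -> P g) ->
    Lim s P h.
  by apply: (gen 0) => g _ ginj _; exact: Pinj.
elim: s us h N {Pinj} => [|j s IH] /= us h N Pg.
  by apply: Pg.
move: us => /andP[js us].
apply: filterS (UU.2 N) => n /= Nn; apply: (IH us _ n.+1) => g gh gi gn.
have gj : g j = n by rewrite gh // /upd eqxx.
apply: Pg.
- move=> i; rewrite inE negb_or => /andP[ij iz]; rewrite gh // /upd.
  by rewrite (negbTE ij).
- move=> i i'; rewrite !inE => /predU1P[->|iS] /predU1P[->|i'S] //.
  + by rewrite gj => ng; move: (gn _ i'S); rewrite -ng ltnn.
  + by rewrite gj => ng; move: (gn _ iS); rewrite ng ltnn.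
  + exact: gi.
- move=> i; rewrite inE => /predU1P[->|iS]; first by rewrite gj.
  by apply: leq_trans (gn _ iS); exact: leqW.
Qed.

Lemma Lim_reindex (sigma : J -> J) s P h : injective sigma ->
  Lim (map sigma s) (fun g => P (g \o sigma)) h <-> Lim s P (h \o sigma).
Proof.
move=> si; elim: s h => [|j s IH] h //=.
suff -> : [set n | Lim (map sigma s) (fun g => P (g \o sigma)) (upd h (sigma j) n)] =
  [set n | Lim s P (upd (h \o sigma) j n)] by [].
have E n : upd h (sigma j) n \o sigma = upd (h \o sigma) j n.
  by apply/funext => i; rewrite /upd /= (inj_eq si).
by apply/seteqP; split=> n /=; rewrite IH E.
Qed.

Definition supported (B : pred J) P :=
  forall g g', {in B, g =1 g'} -> P g -> P g'.

Lemma supportedN (B : pred J) P : supported B P -> supported B (fun g => ~ P g).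
Proof.
by move=> PB g g' gg' nP Pg'; apply: nP; apply: PB Pg' => j /gg'.
Qed.

(** Limits over positions on which P does not depend are limits of constants. *)
Lemma Lim_filter (B : pred J) s P h : supported B P ->
  Lim s P h <-> Lim (seq.filter B s) P h.
Proof.
move=> PB.
suff gen h' : (forall j, B j -> j \notin s -> h j = h' j) ->
  Lim s P h' <-> Lim (seq.filter B s) P h by exact: gen.
elim: s h h' => [|j s IH] h h' hh' /=.
  by split; apply: PB => i iB; rewrite hh'.
case: ifPn => Bj /=.
  suff -> : [set n | Lim s P (upd h' j n)] =
    [set n | Lim (seq.filter B s) P (upd h j n)] by [].
  apply/seteqP; split=> n /=; rewrite (IH (upd h j n)) // => i Bi iS;
    rewrite /upd; case: eqVneq => // ij; apply: hh' => //;
    by rewrite inE negb_or ij.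
have E n : Lim s P (upd h' j n) <-> Lim (seq.filter B s) P h.
  apply: IH => i Bi iS; have ij : i != j by apply: contraNneq Bj => <-.
  by rewrite /upd (negbTE ij); apply: hh' => //; rewrite inE negb_or ij.
split=> [/filter_ex[n /E]//|H].
by apply: filterS (UU.2 0) => n _; exact/E.
Qed.

Variables (leJ : rel J) (leJ_total : total leJ) (leJ_trans : transitive leJ)
  (leJ_anti : antisymmetric leJ).

(** The limits are taken in the order of the positions, which makes the value
    independent of the chosen list of positions supporting P. *)
Definition generic P := exists s,
  [/\ sorted leJ s, uniq s, supported (mem s) P & Lim s P (fun=> 0)].

Lemma genericP P s : sorted leJ s -> uniq s -> supported (mem s) P ->
  generic P <-> Lim s P (fun=> 0).
Proof.
move=> ss us Ps; split=> [[t [st ut Pt Ht]]|]; last by exists s.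
pose r := sort leJ (undup (s ++ t)).
have ur : uniq r by rewrite sort_uniq undup_uniq.
have sr : sorted leJ r by exact: sort_sorted.
have rE q : sorted leJ q -> uniq q -> {subset q <= s ++ t} -> seq.filter (mem q) r = q.
  move=> sq uq qst; apply: (sorted_eq leJ_trans leJ_anti) => //.
    exact: sorted_filter.
  apply: uniq_perm => //; first exact: filter_uniq.
  move=> j; rewrite mem_filter mem_sort mem_undup /=.
  by case: (boolP (j \in q)) => //= /qst ->.
have sE : seq.filter (mem s) r = s by apply: rE => // j js; rewrite mem_cat js.
have tE : seq.filter (mem t) r = t by apply: rE => // j jt; rewrite mem_cat jt orbT.
rewrite -sE; apply/(Lim_filter r (fun=> 0) Ps)/(Lim_filter r (fun=> 0) Pt).
by rewrite tE.
Qed.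

Lemma supported_sorted P (l : seq J) : supported (mem l) P ->
  exists s, [/\ sorted leJ s, uniq s, supported (mem s) P & s =i l].
Proof.
move=> Pl; exists (sort leJ (undup l)).
have E : sort leJ (undup l) =i l by move=> j; rewrite mem_sort mem_undup.
split=> //; first exact: sort_sorted.
  by rewrite sort_uniq undup_uniq.
by move=> g g' gg'; apply: Pl => j jl; apply: gg'; rewrite inE E.
Qed.

Lemma generic_not P (l : seq J) : supported (mem l) P ->
  ~ generic P -> generic (fun g => ~ P g).
Proof.
move=> /supported_sorted[s [ss us Ps _]]; rewrite (genericP ss us Ps) => nP.
by exists s; split=> //; [exact: supportedN|apply/LimN].
Qed.

Lemma generic_and P Q : generic P -> generic Q -> generic (fun g => P g /\ Q g).
Proof.
move=> [s [ss us Ps gP]] [t [st ut Qt gQ]].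
pose r := sort leJ (undup (s ++ t)).
have sr : sorted leJ r by exact: sort_sorted.
have ur : uniq r by rewrite sort_uniq undup_uniq.
have rE j : (j \in r) = (j \in s) || (j \in t).
  by rewrite mem_sort mem_undup mem_cat.
have Pr : supported (mem r) P.
  by move=> g g' gg'; apply: Ps => j js; apply: gg'; rewrite inE rE js.
have Qr : supported (mem r) Q.
  by move=> g g' gg'; apply: Qt => j js; apply: gg'; rewrite inE rE js orbT.
exists r; split=> //.
  by move=> g g' gg' [Pg Qg]; split; [exact: Pr gg' Pg|exact: Qr gg' Qg].
apply/LimI; split; [apply/(genericP sr ur Pr)|apply/(genericP sr ur Qr)].
  by exists s.
by exists t.
Qed.

Lemma generic_true : generic (fun=> True).
Proof. by exists [::]. Qed.

Lemma generic_inj P (l : seq J) : supported (mem l) P ->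
  (forall g, {in l &, injective g} -> P g) -> generic P.
Proof.
move=> /supported_sorted[s [ss us Ps sl]] Pinj; exists s; split=> //.
apply: Lim_generic => // g gi; apply: Pinj => i j il jl; apply: gi;
  by rewrite sl.
Qed.

(** The source of indiscernibility: an iterated limit depends only on the order
    of the positions, not on the positions themselves. *)
Lemma generic_reindex (sigma : J -> J) P (l : seq J) : supported (mem l) P ->
  {homo sigma : i j / leJ i j} -> injective sigma ->
  generic P -> generic (fun g => P (g \o sigma)).
Proof.
move=> /supported_sorted[s [ss us Ps _]] mono si /(genericP ss us Ps) gP.
exists (map sigma s); split.
- exact: homo_sorted ss.
- by rewrite map_inj_uniq.
- by move=> g g' gg'; apply: Ps => j js /=; apply: gg'; exact: map_f.
- exact/(Lim_reindex s P (fun=> 0) si).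
Qed.

End IteratedLimit.

(** * Mutually indiscernible arrays *)

Definition fixing (T : Type) (C : set T) (s : T -> T) := forall c, C c -> s c = c.

Definition along (R V : Type) (row : V -> R) (f : R -> nat) (z : V) : V * nat :=
  (z, f (row z)).

Definition reindex (R V : Type) (row : V -> R) (sigma : R -> nat -> nat)
    (p : V * nat) : V * nat := (p.1, sigma (row p.1) p.2).

(** The index type R names the rows, V the coordinates of the entries of all
    rows, and the coordinate z of the n-th entry of row z is a (z, n).  The new
    array realizes the type of all formulas generically true of a, jointly with
    some b' satisfying Theta at the entries of index 0; this is consistent
    because a generically true formula is true at some renumbering of a, and
    every path of a is consistent with Theta.  As Theta contains the type of b
    over C, an automorphism then moves b' to b.

    The second conclusion transfers properties of distinct entries of a row, such
    as k-inconsistency. *)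
Lemma indiscernible_array (L : language) (K : Type) (M : structure L)
    (R V X : Type) (C : set M) (row : V -> R) (a : V * nat -> M) (b : X -> M)
    (Theta : set (formula L (X + (V + C)))) :
  saturated K M -> strongly_homogeneous K M ->
  smallT K nat -> smallT K V -> smallT K X -> smallT K C ->
  (forall (f : R -> nat) s, (forall phi, List.In phi s -> Theta phi) ->
    exists x : X -> M, forall phi, List.In phi s ->
      sat (tcat x (tcat (a \o along row f) val)) phi) ->
  (forall theta : formula L (X + C), sat (tcat b val) theta ->
    Theta (frename (fun z => match z with inl x => inl x | inr c => inr (inr c) end)
             theta)) ->
  exists a' : V * nat -> M,
  [/\ forall sigma : R -> nat -> nat, (forall r, {homo sigma r : i j / i < j}) ->
        exists s, [/\ automorphism s, fixing C s &
                      forall p, s (a' p) = a' (reindex row sigma p)],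
      forall (theta : formula L ((V * nat) + C)) (l : seq ({classic R} * nat)),
        (forall g : {classic R} * nat -> nat, {in l &, injective g} ->
          sat (tcat (fun p => a (p.1, g (row p.1, p.2))) val) theta) ->
        sat (tcat a' val) theta &
      forall phi, Theta phi ->
        sat (tcat b (tcat (a' \o along row (fun=> 0)) val)) phi].
Proof.
move=> satM homM sN sV sX sC path tpTheta.
pose cval := @set_val _ C.
pose J := ({classic R} * nat)%type : eqType.
have [U UU] := free_ultrafilter_ex.
have [le1 [le1_total le1_trans le1_anti]] := linear_order {classic R}.
(* lexicographic, so that renumbering each row increasingly preserves it *)
pose leJ : rel J := fun p q => if p.1 == q.1 then p.2 <= q.2 else le1 p.1 q.1.
have leJ_total : total leJ.
  move=> p q; rewrite /leJ eq_sym; case: eqP => _; [exact: leq_total|exact: le1_total].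
have leJ_anti : antisymmetric leJ.
  move=> [p i] [q j]; rewrite /leJ /=; case: (eqVneq p q) => [E ij|pq].
    by rewrite E (anti_leq ij).
  by move=> /le1_anti pqE; rewrite pqE eqxx in pq.
have leJ_trans : transitive leJ.
  move=> [q j] [p i] [r k]; rewrite /leJ /=.
  case: (eqVneq p q) => [->|pq]; first by case: ifP => // _; exact: leq_trans.
  case: (eqVneq q r) => [<-|qr]; first by rewrite (negbTE pq).
  case: (eqVneq p r) => [<- pq1 qp1|_]; last exact: le1_trans.
  by move: pq; rewrite (le1_anti p q) ?eqxx // pq1.
pose A (g : J -> nat) (p : V * nat) := a (p.1, g (row p.1, p.2)).
pose val_ (theta : formula L ((V * nat) + C)) (g : J -> nat) :=
  sat (tcat (A g) val) theta.
have supp theta : exists l : seq J, supported (mem l) (val_ theta).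
  have fin : finite_set ((fun p : V * nat => (row p.1, p.2) : J) @`
      (inl @^-1` fvars theta)).
    by apply/finite_image/finite_preimage/fvars_finite => x y _ _ [].
  have /finite_seqP[l lE] := fin; exists l => g g' gg'.
  apply: (iffLR (sat_ext _)) => -[p|c] //= pth; rewrite /A gg' //.
  have : [set` l] ((row p.1, p.2) : J) by rewrite -lE; exists p.
  by [].
pose gen := @generic U J leJ.
pose r1 (z : (V * nat) + C) : ((V * nat) + X) + C :=
  match z with inl p => inl (inl p) | inr c => inr c end.
pose r2 (z : X + (V + C)) : ((V * nat) + X) + C :=
  match z with
  | inl x => inl (inr x)
  | inr (inl z) => inl (inl (z, 0))
  | inr (inr c) => inr c
  end.
have r1E u (x : X -> M) : tcat (tcat u x) val \o r1 = tcat u val by apply/funext => -[].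
have r2E u (x : X -> M) : tcat (tcat u x) val \o r2 =
    tcat x (tcat (u \o along row (fun=> 0)) val).
  by apply/funext => -[|[]].
pose F : set (formula L (((V * nat) + X) + C)) :=
  [set phi | (exists2 th, gen (val_ th) & phi = frename r1 th) \/
             (exists2 th, Theta th & phi = frename r2 th)].
have [|s sF|v vF] := @saturated_realizes L K M _ _ cval F satM sN _ sC.
- by apply: smallT_sum => //; exact: smallT_prod.
- have [P [S [gP ST PS]]] : exists P S, [/\ gen P,
      (forall phi, List.In phi S -> Theta phi) &
      forall g x, P g -> (forall phi, List.In phi S ->
        sat (tcat x (tcat (A g \o along row (fun=> 0)) val)) phi) ->
      forall phi, List.In phi s -> sat (tcat (tcat (A g) x) val) phi].
    elim: s sF => [|phi s IH] sF.
      by exists (fun=> True), [::]; split=> //; exact: generic_true.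
    have [|P [S [gP ST PS]]] := IH; first by move=> psi ?; apply: sF; right.
    have [[th gth phiE]|[th Tth phiE]] := sF phi (or_introl erefl).
      exists (fun g => val_ th g /\ P g), S; split=> //.
        exact: (generic_and UU leJ_total leJ_trans leJ_anti).
      move=> g x [vg Pg] xS psi [<-|]; last exact: PS.
      by rewrite phiE sat_rename r1E.
    exists P, (th :: S); split=> //; first by move=> psi [<-|/ST].
    move=> g x Pg xS psi [<-|]; last by apply: PS => // xi ?; apply: xS; right.
    by rewrite phiE sat_rename r2E; apply: xS; left.
  have [s0 [_ _ _ /(Lim_ex UU)[g Pg]]] := gP.
  have [x xS] := path (fun r => g (r, 0)) S ST.
  by exists (tcat (A g) x); apply: PS.
pose a1 := v \o inl; pose b1 := v \o inr.
have vE : v = tcat a1 b1 by apply/funext => -[].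
have a1gen th : gen (val_ th) -> sat (tcat a1 val) th.
  move=> gth; have : F (frename r1 th) by left; exists th.
  by move=> /vF; rewrite vE sat_rename r1E.
have a1genP th : sat (tcat a1 val) th -> gen (val_ th).
  move=> ath; apply: contrapT => ngen; have [l lth] := supp th.
  apply: (a1gen (fneg th)) ath.
  exact: (generic_not UU leJ_total leJ_trans leJ_anti lth).
have b1Theta th : Theta th -> sat (tcat b1 (tcat (a1 \o along row (fun=> 0)) val)) th.
  move=> Tth; have : F (frename r2 th) by right; exists th.
  by move=> /vF; rewrite vE sat_rename r2E.
have [|th b1th|s [auts sE]] := @homogeneous_automorphism L K M (X + C)
    (tcat b1 cval) (tcat b cval) homM.
- exact: smallT_sum.
- apply: contrapT => nbth; have := b1Theta _ (tpTheta (fneg th) nbth).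
  rewrite sat_rename /=; apply.
  suff -> : tcat b1 (tcat (a1 \o along row (fun=> 0)) val) \o
    (fun z => match z with inl x => inl x | inr c => inr (inr c) end) =
    tcat b1 cval by [].
  by apply/funext => -[].
have sC' (c : C) : s (val c) = val c by exact: (sE (inr c)).
have sfix : fixing C s.
  by move=> c Cc; have := sC' (SigSub (mem_set Cc)).
have sb x : s (b1 x) = b x by exact: (sE (inl x)).
have tE : tcat (s \o a1) cval = s \o tcat a1 cval.
  by apply/funext => -[p|c] //=; rewrite sC'.
exists (s \o a1); split.
- move=> sigma mono.
  have [|th|t [autt tE']] := @homogeneous_automorphism L K M (V * nat + C)
    (tcat (s \o a1) cval) (tcat (s \o a1 \o reindex row sigma) cval) homM.
  + by apply: smallT_sum => //; exact: smallT_prod.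
  + pose rho (z : V * nat + C) : V * nat + C :=
      match z with inl p => inl (reindex row sigma p) | inr c => inr c end.
    have rhoE w : tcat (w \o reindex row sigma) val = tcat w val \o rho.
      by apply/funext => -[].
    rewrite rhoE tE (sat_automorphism _ _ auts) => /a1genP gth.
    rewrite -[s \o _ \o _]/(s \o (tcat a1 val \o rho)) (sat_automorphism _ _ auts).
    apply/sat_rename; apply: a1gen.
    have [l lth] := supp th.
    pose sJ (j : J) : J := (j.1, sigma j.1 j.2).
    have sJi : injective sJ.
      move=> [p i] [q j] [<- ij]; congr pair; apply/eqP; rewrite eqn_leq.
      by apply/andP; split; rewrite leqNgt; apply/negP => /(mono p); rewrite ij ltnn.
    have sJmono : {homo sJ : i j / leJ i j}.
      move=> [p i] [q j]; rewrite /leJ /=; case: eqP => // <-.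
      exact: (ltnW_homo (mono p)).
    have := generic_reindex UU leJ_total leJ_trans leJ_anti lth sJmono sJi gth.
    suff -> : (fun g => val_ th (g \o sJ)) = val_ (frename rho th) by [].
    apply/funext => g; apply/propext; rewrite /val_ sat_rename.
    suff -> : tcat (A (g \o sJ)) cval = tcat (A g) cval \o rho by [].
    by apply/funext => -[].
  exists t; split=> //.
  + by move=> c Cc; exact: (tE' (inr (SigSub (mem_set Cc)))).
  + by move=> p; exact: (tE' (inl p)).
- move=> th l thl; rewrite tE (sat_automorphism _ _ auts); apply: a1gen.
  have [l' l'th] := supp th.
  apply: (generic_inj UU leJ_total (l := l' ++ l)).
    by move=> g g' gg'; apply: l'th => j jl; apply: gg'; rewrite inE mem_cat jl.
  move=> g gi; apply: thl => i j il jl; apply: gi; by rewrite mem_cat ?il ?jl orbT.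
- move=> phi /b1Theta; rewrite -(sat_automorphism _ _ auts).
  suff -> : s \o tcat b1 (tcat (a1 \o along row (fun=> 0)) cval) =
    tcat b (tcat ((s \o a1) \o along row (fun=> 0)) cval) by [].
  by apply/funext => -[x|[z|c]] /=; rewrite ?sb ?sC'.
Qed.

(** The parameters of row i may be given by an infinite tuple, because a formula
    uses only finitely many of them. *)
Lemma inp_pattern_intro (L : language) (M : structure L) (X I : Type)
    (p : set (pformula M X)) (W : I -> Type)
    (phi : forall i, formula L (X + W i)) (e : forall i, nat -> W i -> M)
    (k : I -> nat) :
  (forall i s, uniq s -> size s = k i ->
    ~ exists x : X -> M, forall n, n \in s -> sat (tcat x (e i n)) (phi i)) ->
  (forall f : I -> nat, exists x : X -> M,
    realizes x p /\ forall i, sat (tcat x (e i (f i))) (phi i)) ->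
  has_inp_pattern I p.
Proof.
move=> rows paths.
have restrict i : exists q : {n & (('I_n -> W i) * formula L (X + 'I_n))%type},
    frename (fun z => match z with inl x => inl x | inr j => inr ((tagged q).1 j) end)
      (tagged q).2 = phi i.
  have fin : finite_set ((fun w => w : {classic W i}) @` (inr @^-1` fvars (phi i))).
    by apply/finite_image/finite_preimage/fvars_finite => x y _ _ [].
  have /finite_seqP[s sE] := fin.
  pose sel (j : 'I_(size s)) : W i := tnth (in_tuple s) j.
  have [|psi psiE] := @frename_onto L (X + 'I_(size s)) (X + W i)
      (fun z => match z with inl x => inl x | inr j => inr (sel j) end) (phi i).
    move=> [x|w] zphi; first by exists (inl x).
    have /tnthP[j jE] : (w : {classic W i}) \in in_tuple s.
      have : [set` s] (w : {classic W i}) by rewrite -sE; exists w.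
      by [].
    by exists (inr j) => //; congr inr.
  by exists (existT _ (size s) (sel, psi)).
pose q i := sval (cid (restrict i)); have qE i := svalP (cid (restrict i)).
pose form i := (tagged (q i)).2; pose sel i := (tagged (q i)).1.
have formE x i n : psat x (finst (form i) (e i n \o sel i)) <->
    sat (tcat x (e i n)) (phi i).
  rewrite psat_finst -(qE i) sat_rename.
  suff -> : tcat x (e i n) \o
    (fun z => match z with inl x => inl x | inr j => inr (sel i j) end) =
    tcat x (e i n \o sel i) by [].
  by apply/funext => -[].
constructor; apply: (@InpPattern L M X I p (fun i => tag (q i))
  (fun i n => e i n \o sel i) form k).
- move=> i s us sk cons; apply: (rows i s us sk).
  have [|x xG] := cons _ _ (@subset_refl _ _); first exact/finite_image/finite_seq.
  by exists x => n ns; apply/formE/xG; exists n.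
- move=> f D _ Dsub; have [x [xp xphi]] := paths f.
  by exists x => psi /Dsub[[i _ <-]|/xp//]; exact/formE.
Qed.

Lemma indiscernible_inp_pattern (L : language) (K : Type) (M : structure L)
    (R X : Type) (C : set M) (b : X -> M) :
  saturated K M -> strongly_homogeneous K M ->
  smallT K nat -> smallT K R -> smallT K X -> smallT K C ->
  has_inp_pattern R (tp b C) ->
  exists (len : R -> nat) (form : forall r, formula L (X + 'I_(len r)))
    (k : R -> nat) (a : {r & 'I_(len r)} * nat -> M),
  [/\ forall sigma : R -> nat -> nat, (forall r, {homo sigma r : i j / i < j}) ->
        exists s, [/\ automorphism s, fixing C s &
                      forall p, s (a p) = a (reindex tag sigma p)],
      forall r s, uniq s -> size s = k r -> ~ exists x : X -> M, forall n, n \in s ->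
        sat (tcat x (fun j => a (Tagged (fun r => 'I_(len r)) j, n))) (form r) &
      forall r, sat (tcat b (fun j => a (Tagged (fun r => 'I_(len r)) j, 0))) (form r)].
Proof.
move=> satM homM sN sR sX sC [[len param form k row path]].
exists len, form, k.
pose V := {r & 'I_(len r)}; pose cval := @set_val _ C.
pose a0 (p : V * nat) := param (tag p.1) p.2 (tagged p.1).
pose tgd r (j : 'I_(len r)) : V := Tagged (fun r => 'I_(len r)) j.
pose rPhi r (z : X + 'I_(len r)) : X + (V + C) :=
  match z with inl x => inl x | inr j => inr (inl (tgd r j)) end.
pose rTp (z : X + C) : X + (V + C) :=
  match z with inl x => inl x | inr c => inr (inr c) end.
pose Theta : set (formula L (X + (V + C))) := [set phi |
  (exists r, phi = frename (@rPhi r) (form r)) \/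
  (exists2 th, sat (tcat b cval) th & phi = frename rTp th)].
have sV : smallT K V.
  apply: (@smallT_sigT K R (fun r => 'I_(len r)) nat) => // r.
  by exists val; exact: val_inj.
have [|th bth|a [shift inj aTheta]] := @indiscernible_array L K M R V X C tag a0 b Theta
    satM homM sN sV sX sC.
- move=> f s sTheta.
  pose D := (fun phi => finst phi (tcat (a0 \o along tag f) cval)) @`
    [set phi | List.In phi s].
  have [|_ [phi /sTheta[[r ->]|[th bth ->]] <-]|x xD] := path f D.
  + exact/finite_image/finite_In.
  + left; exists r => //; rewrite /finst frename_comp; congr frename.
    by apply/funext => -[].
  + right; split; last first.
      rewrite /= psat_finst sat_rename.
      suff -> : tcat b (tcat (a0 \o along tag f) cval) \o rTp = tcat b cval by [].
      by apply/funext => -[].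
    exists th => //; rewrite /finst frename_comp; congr frename.
    by apply/funext => -[].
  + exists x => phi phis; apply/psat_finst/xD; by exists phi.
- by right; exists th.
exists a; split=> [//|r s us sk|r]; last first.
  have : Theta (frename (@rPhi r) (form r)) by left; exists r.
  move=> /aTheta; rewrite sat_rename.
  suff -> : tcat b (tcat (a \o along tag (fun=> 0)) cval) \o @rPhi r =
    tcat b (fun j => a (tgd r j, 0)) by [].
  by apply/funext => -[].
pose rn n (z : X + 'I_(len r)) : X + (V * nat + C) :=
  match z with inl x => inl x | inr j => inr (inl (tgd r j, n)) end.
have [psi psiE] := formula_exists (fconj [seq frename (rn n) (form r) | n <- s]).
have psiP (w : V * nat -> M) : sat (tcat w cval) psi <->
    exists x : X -> M, forall n, n \in s ->
      sat (tcat x (fun j => w (tgd r j, n))) (form r).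
  have E x n : tcat x (tcat w cval) \o rn n = tcat x (fun j => w (tgd r j, n)).
    by apply/funext => -[].
  rewrite psiE; split=> -[x H]; exists x.
    move: H => /sat_fconj H n ns; rewrite -E -sat_rename; apply: H.
    elim: (s) ns => //= m s' IH; rewrite inE => /predU1P[->|/IH]; [by left|by right].
  apply/sat_fconj => phi phis.
  have [n ns ->] : exists2 n, n \in s & phi = frename (rn n) (form r).
    elim: (s) phis => //= m s' IH [<-|/IH[n ns ->]].
      by exists m; rewrite ?mem_head.
    by exists n; rewrite // inE ns orbT.
  by rewrite sat_rename E; exact: H.
move=> /psiP; apply: (inj (fneg psi) [seq ((r : {classic R}), n) | n <- s]) => g gi.
move=> /psiP[x xs].
apply: (row r [seq g ((r : {classic R}), n) | n <- s]).
- rewrite map_inj_in_uniq // => m n ms ns gmn.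
  by have [] := gi _ _ (map_f _ ms) (map_f _ ns) gmn.
- by rewrite size_map.
move=> D _ Dsub; exists x => phi /Dsub[n /mapP[m ms ->] <-].
by apply/psat_finst; exact: xs.
Qed.

(** * Submultiplicativity *)

(** Used to move the first entries of a row onto any given entries by one
    increasing renumbering of the row. *)
Lemma increasing_enum (s : seq nat) : uniq s ->
  exists sigma : nat -> nat, {homo sigma : i j / i < j} /\
    forall i, i < size s -> sigma i \in s.
Proof.
move=> us; pose t := sort leq s.
have tlt : sorted ltn t.
  by rewrite ltn_sorted_uniq_leq sort_uniq us sort_sorted //; exact: leq_total.
have tst : size t = size s by rewrite size_sort.
have tsum i : nth 0 t i <= sumn t.
  elim: (t) i => [|x t' IH] [|i] //=; first exact: leq_addr.
  by apply: leq_trans (IH i) _; exact: leq_addl.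
exists (fun i => if i < size s then nth 0 t i else i + (sumn t).+1); split.
  move=> i j ij; case: (ltnP i (size s)) => ilt; case: (ltnP j (size s)) => jlt.
  - by apply: (sorted_ltn_nth ltn_trans) => //; rewrite inE tst.
  - by apply: leq_trans (leq_addl _ _); rewrite ltnS.
  - by move: (leq_ltn_trans ilt ij); rewrite ltnNge ltnW.
  - by rewrite ltn_add2r.
by move=> i ilt; rewrite ilt -(mem_sort leq) mem_nth // tst.
Qed.

Section Submultiplicativity.

Variables (L : language) (K : Type) (M : structure L) (C : set M).
Variables (X1 X2 : Type) (b1 : X1 -> M) (b2 : X2 -> M) (kappa1 kappa2 : Type).
Hypotheses (satM : saturated K M) (homM : strongly_homogeneous K M).
Hypotheses (smallN : smallT K nat) (smallC : smallT K C).
Hypothesis small1 : smallT K X1.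
Hypotheses (smallK1 : smallT K kappa1) (smallK2 : smallT K kappa2).

Let R := (kappa1 * kappa2)%type.

Variables (len : R -> nat) (form : forall r, formula L ((X1 + X2) + 'I_(len r))).
Variables (k : R -> nat).

Let V := {r & 'I_(len r)}.
Let tgd r (j : 'I_(len r)) : V := Tagged (fun r => 'I_(len r)) j.
Let cval := @set_val _ C.

Variable (a : V * nat -> M).
Hypothesis shift : forall sigma : R -> nat -> nat,
  (forall r, {homo sigma r : i j / i < j}) ->
  exists s, [/\ automorphism s, fixing C s &
                forall p, s (a p) = a (reindex tag sigma p)].
Hypothesis rows : forall r s, uniq s -> size s = k r ->
  ~ exists x : X1 + X2 -> M, forall n, n \in s ->
      sat (tcat x (fun j => a (@tgd r j, n))) (form r).
Hypothesis path0 : forall r,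
  sat (tcat (tcat b1 b2) (fun j => a (@tgd r j, 0))) (form r).

Implicit Types (E : set R) (r : R) (f : R -> nat).

Let y f : V -> M := a \o along tag f.

Let at_path (x : X1 -> M) f := tcat x (tcat (y f) cval).

(** Rows competing with a selected row for the same second index are forgotten;
    this set shrinks as E grows. *)
Let kept E r := forall alpha, E (alpha, r.2) -> alpha = r.1.

(** A pair (theta, f) in Gamma E stands for the formula theta(x1, a_f): it
    is required of x1 since theta holds of b1 at the entries of index 0 and f
    moves only entries of rows in E. *)
Let Gamma E (pr : formula L (X1 + (V + C)) * (R -> nat)) :=
  [/\ forall z, fvars pr.1 (inr (inl z)) -> kept E (tag z),
      forall r, ~ E r -> pr.2 r = 0 &
      sat (at_path b1 (fun=> 0)) pr.1].

Let functional E := forall alpha alpha' beta,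
  E (alpha, beta) -> E (alpha', beta) -> alpha = alpha'.

Let good E := functional E /\
  forall s, (forall pr, List.In pr s -> Gamma E pr) ->
    exists x, forall pr, List.In pr s -> sat (at_path x pr.2) pr.1.

Let small_V : smallT K V.
Proof.
apply: (@smallT_sigT K R (fun r => 'I_(len r)) nat) => //; first exact: smallT_prod.
by move=> r; exists val; exact: val_inj.
Qed.

Lemma good_set0 : good set0.
Proof.
split=> // s sG; exists b1 => pr /sG[_ f0 satpr].
by rewrite (_ : pr.2 = fun=> 0) //; apply/funext => r; exact: f0.
Qed.

(** The kept rows of the union are kept at each stage.  The rows occurring in
    finitely many formulas see only one stage E of the chain, so the paths may be
    cut down to E there. *)
Lemma good_bigcup (F : set (set R)) : F !=set0 -> F `<=` good ->
  total_on F subset -> good (\bigcup_(E in F) E).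
Proof.
move=> F0 Fgood Ftot; set U := \bigcup_(E in F) E; split.
  move=> al al' be [E FE Eal] [E' FE' Eal'].
  have [EE|EE] := Ftot _ _ FE FE'.
    by apply: (Fgood _ FE').1 Eal'; exact: EE.
  by apply: (Fgood _ FE).1 Eal _; exact: EE.
move=> s sU.
have [l lE] : exists l, forall z,
    fvars (fconj (map fst s)) (inr (inl z)) -> List.In (tag z) l.
  have [|l lE] := @finite_list _ ((fun z : V => tag z) @`
      ((inr \o inl) @^-1` fvars (fconj (map fst s)))).
    by apply/finite_image/finite_preimage/fvars_finite => x z _ _ [].
  by exists l => z zs; apply/lE; exists z.
have [E FE El] := chain_finite l F0 Ftot.
pose cut f r := if `[< E r >] then f r else 0.
have [|x xs] := (Fgood _ FE).2 [seq (pr.1, cut pr.2) | pr <- s].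
  move=> _ /List.in_map_iff[pr [<- /sU[kpr f0 satpr]]]; split=> //=.
    by move=> z /kpr kz al Eal; apply: kz; exists E.
  by move=> r nEr; rewrite /cut asboolF.
exists x => -[th f] prs.
have := xs (th, cut f); rewrite List.in_map_iff => /(_ _)/= H.
apply: (iffLR (sat_ext _)) (H _); last by exists (th, f).
move=> [//|[z|//]] zth /=; rewrite /y /along /= /cut.
case: asboolP => // nEz; have [_ /= f0 _] := sU _ prs.
rewrite f0 // => Uz; apply: nEz; apply: El Uz; apply: lE.
apply: (@fvars_fconj _ _ _ th) zth.
by apply/List.in_map_iff; exists (th, f).
Qed.

Lemma good_realized E : good E ->
  exists x, forall pr, Gamma E pr -> sat (at_path x pr.2) pr.1.
Proof.
move=> [_ Efip].
pose rho f (z : X1 + (V + C)) : X1 + (V * nat + C) := match z with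
  | inl x => inl x | inr (inl z) => inr (inl (along tag f z))
  | inr (inr c) => inr (inr c) end.
have rhoE x f th : sat (tcat x (tcat a cval)) (frename (rho f) th) <->
    sat (at_path x f) th.
  rewrite sat_rename (_ : _ \o _ = at_path x f) //.
  by apply/funext => -[|[]].
have [||s sG|x xG] := @saturated_realizes_image L K M X1 (V * nat + C) _
    (tcat a cval) (Gamma E) (fun pr => frename (rho pr.2) pr.1) satM smallN.
- exact: small1.
- by apply: smallT_sum => //; exact: smallT_prod.
- by have [x xs] := Efip s sG; exists x => pr /xs; rewrite rhoE.
- by exists x => pr /xG; rewrite rhoE.
Qed.

(** For each path f moving only rows of E, an automorphism over C carries b1 to
    x and the entries 0 of the rows of E to their entries along f.  The image of
    b2 solves the path f over x, and the inverse of the automorphism for f = 0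
    brings the solution back over b1. *)
Lemma inp_pattern_over_b1 E : functional E ->
  (forall beta, exists alpha, E (alpha, beta)) ->
  (exists x, forall pr, Gamma E pr -> sat (at_path x pr.2) pr.1) ->
  has_inp_pattern kappa2 (tp b2 (range b1 `|` C)).
Proof.
move=> Efun /choice[g gE] [x xG].
have conj f : (forall r, ~ E r -> f r = 0) -> exists s, [/\ automorphism s,
    fixing C s, forall i, s (b1 i) = x i &
    forall r j, E r -> s (a (@tgd r j, 0)) = a (tgd j, f r)].
  move=> f0; pose Vk := {z : V | kept E (tag z)}.
  have [|th b1th|s [auts sE]] := @homogeneous_automorphism L K M (X1 + (Vk + C))
    (tcat b1 (tcat (y (fun=> 0) \o sval) cval)) (tcat x (tcat (y f \o sval) cval)) homM.
  - apply: smallT_sum => //; apply: smallT_sum => //.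
    by apply: smallT_embeds small_V; exists sval; exact: sval_inj.
  - pose rho (z : X1 + (Vk + C)) : X1 + (V + C) := match z with
      | inl i => inl i | inr (inl z) => inr (inl (sval z))
      | inr (inr c) => inr (inr c) end.
    have rhoE u w :
        tcat u (tcat (w \o sval) cval) = tcat u (tcat w cval) \o rho :> (_ -> M).
      by apply/funext => -[|[]].
    rewrite rhoE -(sat_rename rho (tcat x (tcat (y f) cval))).
    apply: (xG (frename rho th, f)); split=> //=.
      move=> z /(@fvars_rename _ _ _ rho)[[|[[z' kz']|]]]// _ [<-] //.
    by rewrite sat_rename -rhoE.
  - exists s; split=> //.
    + by move=> c Cc; exact: (sE (inr (inr (SigSub (mem_set Cc))))).
    + by move=> i; exact: (sE (inl i)).
    + move=> r j Er; have kr : kept E (tag (tgd j)).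
        by move=> al Eal; case: r j Er Eal => al' be j /Efun/[apply].
      exact: (sE (inr (inl (exist _ (tgd j) kr)))).
have [s0 [auts0 s0C s0b1 _]] := conj (fun=> 0) (fun _ _ => erefl).
have [s0' [auts0' s0K s0'K]] := automorphism_inv auts0.
pose row beta : R := (g beta, beta).
pose rho beta (z : (X1 + X2) + 'I_(len (row beta))) : X2 + (X1 + 'I_(len (row beta))) :=
  match z with inl (inl i) => inr (inl i) | inl (inr i) => inl i
  | inr j => inr (inr j) end.
apply: (@inp_pattern_intro L M X2 kappa2 _ (fun beta => (X1 + 'I_(len (row beta)))%type)
  (fun beta => frename (@rho beta) (form (row beta)))
  (fun beta n => tcat b1 (fun j => s0' (a (tgd j, n))))
  (fun beta => k (row beta))).
- move=> beta s us sk [u uS]; apply: (rows us sk).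
  exists (s0 \o tcat b1 u) => n /uS.
  rewrite sat_rename -(sat_automorphism _ _ auts0).
  rewrite (_ : s0 \o _ = tcat (s0 \o tcat b1 u) (fun j => a (tgd j, n))) //.
  by apply/funext => -[[i|i]|j] //=; rewrite s0'K.
- move=> f; pose f' r := if `[< E r >] then f r.2 else 0.
  have f'0 r : ~ E r -> f' r = 0 by move=> nE; rewrite /f' asboolF.
  have [s [auts sC sb1 sa]] := conj f' f'0.
  have autt := automorphism_comp auts0' auts.
  have tb1 i : s0' (s (b1 i)) = b1 i by rewrite sb1 -s0b1 s0K.
  have tC c : C c -> s0' (s c) = c by move=> Cc; rewrite sC // -{1}(s0C c Cc) s0K.
  exists ((s0' \o s) \o b2); split.
    move=> _ [[th _ <-] +]; rewrite /= !psat_finst.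
    rewrite -(sat_automorphism _ _ autt).
    rewrite (_ : (s0' \o s) \o _ = tcat ((s0' \o s) \o b2) val) //.
    apply/funext => -[i|c] //=; case: (set_mem (valP c)) => [[i _ <-]|Cc].
      exact: tb1.
    exact: tC.
  move=> beta; rewrite sat_rename.
  rewrite (_ : _ \o _ = (s0' \o s) \o
      tcat (tcat b1 b2) (fun j => a (@tgd (row beta) j, 0))).
    by apply/(sat_automorphism _ _ autt); exact: path0.
  apply/funext => -[[i|i]|j] //=.
  by rewrite (sa _ j (gE beta)) /f' asboolT //; exact: gE.
Qed.

(** The formula chi_alpha is the conjunction of the finitely many formulas
    witnessing that (alpha, beta0) cannot be added, with the entry of row
    (alpha, beta0) as its only varying parameter.  Its instances at the entries
    of index below N alpha jointly contain all the witnessing formulas, so they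
    are inconsistent. *)
Lemma inp_pattern_over_C E beta0 : (forall alpha, ~ E (alpha, beta0)) ->
  (exists x, forall pr, Gamma E pr -> sat (at_path x pr.2) pr.1) ->
  (forall alpha, exists2 s,
     forall pr, List.In pr s -> Gamma (E `|` [set (alpha, beta0)]) pr &
     ~ exists x, forall pr, List.In pr s -> sat (at_path x pr.2) pr.1) ->
  has_inp_pattern kappa1 (tp b1 C).
Proof.
move=> nE [x1 x1G] bad.
pose S alpha := s2val (cid2 (bad alpha)).
have SG alpha : forall pr, List.In pr (S alpha) ->
    Gamma (E `|` [set (alpha, beta0)]) pr.
  exact: (s2valP (cid2 (bad alpha))).
have Sbad alpha : ~ exists x, forall pr, List.In pr (S alpha) ->
    sat (at_path x pr.2) pr.1.
  exact: (s2valP' (cid2 (bad alpha))).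
have bound alpha : exists N, forall pr, List.In pr (S alpha) -> pr.2 (alpha, beta0) < N.
  elim: (S alpha) => [|pr s [N sN]]; first by exists 0.
  exists (maxn (pr.2 (alpha, beta0)).+1 N) => pr' [<-|/sN]; first by rewrite leq_maxl.
  by move=> ?; rewrite leq_max orbC; apply/orP; left.
have [N SN] := choice bound.
pose put f r n : R -> nat := fun q => if `[< q = r >] then n else f q.
(* a copy of the array variables for each path, so that formulas along different
   paths can share one parameter tuple *)
pose W := ((R -> nat) * V + C)%type.
pose rho f (z : X1 + (V + C)) : X1 + W := match z with
  | inl i => inl i | inr (inl z) => inr (inl (f, z))
  | inr (inr c) => inr (inr c) end.
pose chi alpha := fconj [seq frename (rho pr.2) pr.1 | pr <- S alpha].
pose e alpha n : W -> M := tcat (fun q => y (put q.1 (alpha, beta0) n) q.2) cval.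
have chiE alpha n x : sat (tcat x (e alpha n)) (chi alpha) <->
    forall pr, List.In pr (S alpha) -> sat (at_path x (put pr.2 (alpha, beta0) n)) pr.1.
  have eE f : tcat x (e alpha n) \o rho f = at_path x (put f (alpha, beta0) n).
    by apply/funext => -[|[]].
  rewrite /chi sat_fconj; split=> [H pr prS|H _ /List.in_map_iff[pr [<- /H]]].
    by rewrite -eE -sat_rename; apply: H; apply/List.in_map_iff; exists pr.
  by rewrite sat_rename eE.
apply: (@inp_pattern_intro L M X1 kappa1 _ (fun=> W) chi e N).
- move=> alpha s us sN [x xs].
  have [sigma [mono sigmas]] := increasing_enum us.
  pose tau r := if `[< r = (alpha, beta0) >] then sigma else id.
  have [|u [autu uC ua]] := shift (sigma := tau).
    by move=> r i j ij; rewrite /tau; case: asboolP => // _; exact: mono.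
  have [u' [autu' uK u'K]] := automorphism_inv autu.
  apply: (Sbad alpha); exists (u' \o x) => -[th f] prS /=.
  set n := f (alpha, beta0); have nN : n < N alpha := SN alpha _ prS.
  have /chiE/(_ _ prS)/= := xs (sigma n) (sigmas n (etrans (congr1 (leq n.+1) sN) nN)).
  rewrite -[X in _ -> X](sat_automorphism _ _ autu).
  rewrite (_ : u \o _ = at_path x (put f (alpha, beta0) (sigma n))) //.
  apply/funext => -[i|[z|c]] /=; first by rewrite u'K.
    rewrite ua /y /along /reindex /tau /put /=.
    by case: asboolP => // ->.
  by rewrite uC //; exact: set_mem (valP c).
- move=> f; pose tau (r : R) := if `[< r.2 = beta0 >] then (addn (f r.1)) else id.
  have [|u [autu uC ua]] := shift (sigma := tau).
    by move=> r i j ij; rewrite /tau; case: asboolP => // _; rewrite ltn_add2l.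
  exists (u \o x1); split.
    move=> _ [[th _ <-] +]; rewrite /= !psat_finst => b1th.
    rewrite (_ : tcat (u \o x1) val = u \o tcat x1 val); last first.
      apply/funext => -[i|c] //=; rewrite uC //; exact: set_mem (valP c).
    apply/(sat_automorphism _ _ autu).
    pose rTp (z : X1 + C) : X1 + (V + C) :=
      match z with inl i => inl i | inr c => inr (inr c) end.
    have rTpE x f' : at_path x f' \o rTp = tcat x val by apply/funext => -[].
    rewrite -(rTpE x1 (fun=> 0)) -sat_rename.
    apply: (x1G (frename rTp th, fun=> 0)); split=> //=; last first.
      by rewrite sat_rename rTpE.
    by move=> z /(@fvars_rename _ _ _ rTp)[[]].
  move=> alpha; apply/chiE => -[th h] prS /=.
  have [/= kth h0 b1th] := SG _ _ prS.
  have := x1G (th, put h (alpha, beta0) 0).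
  rewrite -(sat_automorphism _ _ autu) => /= H.
  apply: (iffLR (sat_ext _)) (H _); last first.
    split=> //= [z /kth kz al Eal|r nEr]; first by apply: kz; left.
    by rewrite /put; case: asboolP => // nr; apply: h0 => -[|].
  move=> [//|[z|c]] zth /=; last by rewrite uC //; exact: set_mem (valP c).
  rewrite ua /y /along /reindex /tau /put /=.
  have kz := kth z zth; case: (asboolP (tag z = (alpha, beta0))) => [->|nz] /=.
    by rewrite asboolT // addn0.
  case: (asboolP ((tag z).2 = beta0)) => // zb; case: nz.
  rewrite [LHS]surjective_pairing zb; congr pair.
  by rewrite (kz alpha) //; right; rewrite zb.
Qed.

Lemma inp_pattern_of_product :
  has_inp_pattern kappa1 (tp b1 C) \/
  has_inp_pattern kappa2 (tp b2 (range b1 `|` C)).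
Proof.
have [E [goodE _ Emax]] := Zorn_above good_set0 good_bigcup.
have real := good_realized goodE; have [Efun _] := goodE.
have [tot|/existsNP[beta0 nE]] := pselect (forall beta, exists alpha, E (alpha, beta)).
  by right; exact: (inp_pattern_over_b1 Efun).
have nE' alpha : ~ E (alpha, beta0) by move=> Ea; apply: nE; exists alpha.
left; apply: (inp_pattern_over_C nE' real) => alpha; apply: contrapT => nbad.
suff EE : E `|` [set (alpha, beta0)] = E by apply: (nE' alpha); rewrite -EE; right.
apply: Emax; first by move=> r; left.
split.
  move=> al al' be [Eal|[-> ->]] [Eal'|[]].
  - exact: Efun Eal Eal'.
  - by move=> _ E2; case: (nE' al); rewrite -E2.
  - by case: (nE' al').
  - by move=> ->.
move=> s sG; apply: contrapT => nx; apply: nbad; by exists s.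
Qed.

End Submultiplicativity.

Theorem theorem2p5 (L : language) (T : set (sentence L)) (K : Type)
    (M : structure L) (C : set M) (X1 X2 : Type) (b1 : X1 -> M) (b2 : X2 -> M)
    (kappa1 kappa2 : Type) :
  complete_theory T ->
  monster T K M ->
  small K C ->
  small K [set: X1] -> small K [set: X2] ->
  small K [set: kappa1] -> small K [set: kappa2] ->
  has_inp_pattern (kappa1 * kappa2)%type (tp (tcat b1 b2) C) ->
  has_inp_pattern kappa1 (tp b1 C) \/
  has_inp_pattern kappa2 (tp b2 (range b1 `|` C)).
Proof.
move=> _ [[/smallTP sN _ _] _ satM homM] /small_setP sC.
move=> /smallTP s1 /smallTP s2 /smallTP sk1 /smallTP sk2.
have sR := smallT_prod sN sk1 sk2; have sX := smallT_sum sN s1 s2.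
move=> /(indiscernible_inp_pattern satM homM sN sR sX sC).
move=> [len [form [k [a [shift rows path0]]]]].
exact: (inp_pattern_of_product satM homM sN sC s1 sk1 sk2 shift rows path0).
Qed.
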